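(* Let $K$ be a field, $\lambda\in K$, let $X$ be a well-ordered set and $\Omega=\bigcup_{n\ge 1}\Omega_n$ a well-ordered set of operator symbols ($\Omega_n$ being the $n$-ary ones). Let $D\langle X;\Omega\rangle$ be the free $\lambda$-differential associative algebra with multiple operators $\Omega$ on $X$, with $K$-basis $\mathfrak{L}(X)$ and with the order $>$ on $\mathfrak{L}(X)$ described in the context. Let $S$ be a monic subset of $D\langle X;\Omega\rangle$ and let $Id(S)$ be the ideal of $D\langle X;\Omega\rangle$ generated by $S$. Then the following statements are equivalent: (I) $S$ is a Gröbner-Shirshov basis in $D\langle X;\Omega\rangle$. (II) For every $0\ne f\in Id(S)$ there exist $u\in\mathfrak{L}^\star(X)$, $s\in S$ and $i\ge 0$ such that $\bar f=u|_{\overline{D^{i}(s)}}$. (III) The set $$Irr(S)=\{w\in\mathfrak{L}(X)\mid w\ne u|_{\overline{D^i(s)}} \text{ for all } s\in S,\ i\ge 0,\ u\in\mathfrak{L}^\star(X) \text{ such that } u|_{D^i(s)} \text{ is a normal } D^i(s)\text{-word}\}$$ is a $K$-basis of $D\langle X;\Omega|S\rangle=D\langle X;\Omega\rangle/Id(S)$ (that is, the images of its elements in the quotient form a $K$-basis).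
   Context: **The free algebra.** A $\lambda$-differential algebra is an associative $K$-algebra $R$ (not necessarily unital) with a $K$-linear map $D:R\to R$ satisfying $D(xy)=D(x)y+xD(y)+\lambda D(x)D(y)$. A $\lambda$-differential associative algebra with multiple operators $\Omega$ is such an $R$ together with an $n$-linear map $R^n\to R$ for each $\theta\in\Omega_n$, $n\ge1$. For a set $Y$ let $D^{\omega}(Y)=\{D^i(y)\mid i\ge 0,\ y\in Y\}$ be a set of formal symbols, with $D^0(y)=y$, and let $S(Y)$ denote the free semigroup (nonempty words) on $Y$. Put $X_0=X$, $\mathfrak{L}_0=S(D^{\omega}(X_0))$ and, for $n\ge1$, $X_n=X\cup\Omega(\mathfrak{L}_{n-1})$, $\mathfrak{L}_n=S(D^{\omega}(X_n))$, where $\Omega(\mathfrak{L})=\bigcup_{t\ge1}\{\delta(y_1,\dots,y_t)\mid\delta\in\Omega_t,\ y_i\in\mathfrak{L}\}$ (formal expressions). Then $\mathfrak{L}_0\subset\mathfrak{L}_1\subset\cdots$; put $\mathfrak{L}(X)=\bigcup_n\mathfrak{L}_n$. Each $v\in\mathfrak{L}(X)$ is uniquely $v=v_1\cdots v_n$ with $v_i\in D^{\omega}(X\cup\Omega(\mathfrak{L}(X)))$; put $bre(v)=n$. Let $D\langle X;\Omega\rangle=K\mathfrak{L}(X)$ be the semigroup algebra. The linear map $D$ on it is defined on words by induction on breadth: $D(D^i(y))=D^{i+1}(y)$ for $y\in X\cup\Omega(\mathfrak{L}(X))$, and $D(u_1u_2\cdots u_t)=\lambda D(u_1)D(u_2\cdots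 u_t)+D(u_1)u_2\cdots u_t+u_1D(u_2\cdots u_t)$ for $t>1$. Each $\theta\in\Omega_n$ acts by $(v_1,\dots,v_n)\mapsto\theta(v_1,\dots,v_n)$ on words, extended multilinearly. This is the free $\lambda$-differential associative algebra on $X$ with multiple operators $\Omega$. An ideal of it is an ideal of the associative algebra that is closed under $D$ and under the operators of $\Omega$ (i.e. $\theta(\dots,f,\dots)$ lies in the ideal whenever one argument $f$ does). **The order.** Let $deg_\Omega(u)$ be the number of occurrences of symbols of $\Omega$ in $u$. All tuples are compared lexicographically. On $\mathfrak{L}_0$: $D^i(x)>D^j(y)$ ($x,y\in X$) if $(i,x)>(j,y)$; and $u_1\cdots u_t>v_1\cdots v_s$ ($u_i,v_j\in D^\omega(X)$) if $(t,u_1,\dots,u_t)>(s,v_1,\dots,v_s)$. For $n>0$, by induction: on $X_n$, every $x\in X$ is smaller than every element of $\Omega(\mathfrak{L}_{n-1})$, and $u=\theta_t(u_1,\dots,u_t)>v=\delta_s(v_1,\dots,v_s)$ if $(deg_\Omega(u),\theta_t,u_1,\dots,u_t)>(deg_\Omega(v),\delta_s,v_1,\dots,v_s)$; on $D^\omega(X_n)$, $D^i(u)>D^j(v)$ ($u,v\in X_n$) if $(deg_\Omega(u),i,u)>(deg_\Omega(v),j,v)$; on $\mathfrak{L}_n$, $u=u_1\cdots u_t>v=v_1\cdots v_s$ if $(deg_\Omega(u),bre(u),u_1,\dots,u_t)>(deg_\Omega(v),bre(v),v_1,\dots,v_s)$. This gives a well ordering on $\mathfrak{L}(X)$. For $0\ne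 f\in D\langle X;\Omega\rangle$, $\bar f$ is the largest word occurring in $f$ with nonzero coefficient, $lc(f)$ is its coefficient, and $f$ is monic if $lc(f)=1$. A subset is monic if all its elements are. **$\star$-words.** For $\star\notin X$, $\mathfrak{L}^\star(X)$ is the set of elements of $\mathfrak{L}(X\cup\{\star\})$ with exactly one occurrence of $\star$. For $u\in\mathfrak{L}^\star(X)$ and $s\in D\langle X;\Omega\rangle$, $u|_s\in D\langle X;\Omega\rangle$ is obtained by replacing $\star$ by $s$ and evaluating in $D\langle X;\Omega\rangle$; it is called an $s$-word. It is a normal $s$-word if $\overline{u|_s}=u|_{\bar s}$. **Compositions.** Let $f,g\in D\langle X;\Omega\rangle$ be monic and $i,j\ge0$. (i) If $w=\overline{D^i(f)}\,a=b\,\overline{D^j(g)}$ for some $a,b\in\mathfrak{L}(X)$ with $bre(w)<bre(\bar f)+bre(\bar g)$, then $(f,g)_w=lc(D^i(f))^{-1}D^i(f)a-lc(D^j(g))^{-1}bD^j(g)$ is an intersection composition. (ii) If $w=\overline{D^i(f)}=u|_{\overline{D^j(g)}}$ for some $u\in\mathfrak{L}^\star(X)$, then $(f,g)_w=lc(D^i(f))^{-1}D^i(f)-lc(D^j(g))^{-1}u|_{D^j(g)}$ is an including composition. **Gröbner-Shirshov basis.** For a monic set $S$, $w\in\mathfrak{L}(X)$ and $p,q\in D\langle X;\Omega\rangle$, write $p\equiv q\ mod(S,w)$ if $p-q=\sum\alpha_iu_i|_{D^{l_i}(s_i)}$ (finite sum) with $\alpha_i\in K$, $u_i\in\mathfrak{L}^\star(X)$,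 $s_i\in S$, $l_i\ge0$, each $u_i|_{D^{l_i}(s_i)}$ a normal $D^{l_i}(s_i)$-word and $u_i|_{\overline{D^{l_i}(s_i)}}<w$. $S$ is a Gröbner-Shirshov basis if every composition $(f,g)_w$ with $f,g\in S$ satisfies $(f,g)_w\equiv0\ mod(S,w)$. *)

(* Defs.v *)
From HB Require Import structures.
From mathcomp Require Import all_boot all_order all_algebra.
From mathcomp Require Import finmap ring_quotient boolp.
From mathcomp.multinomials Require Import monalg.

Set Implicit Arguments.
Unset Strict Implicit.
Unset Printing Implicit Defensive.

Import Order.TTheory GRing.Theory.

Local Open Scope ring_scope.
Local Open Scope quotient_scope.

(* Bases of a vector space as families, with no finiteness assumption: the
   family is [e] restricted to the indices satisfying [P], and a finitely
   supported family of coefficients is an element of [{malg K[I]}]. *)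
Section Basis.
Variables (K : fieldType) (V : lmodType K) (I : choiceType).

Definition lincomb (e : I -> V) (c : {malg K[I]}) : V :=
  \sum_(i <- msupp c) c@_i *: e i.

Definition supported (P : I -> Prop) (c : {malg K[I]}) : Prop :=
  forall i, i \in msupp c -> P i.

Definition is_basis (P : I -> Prop) (e : I -> V) : Prop :=
  (forall c, supported P c -> lincomb e c = 0 -> c = 0) /\
  (forall v, exists2 c, supported P c & v = lincomb e c).

End Basis.

(* [Quotient.quot] is only a Z-module in the library, and it expects a
   [zmodClosed], which a [submodClosed] over a ring is not by inheritance. *)
Section LmodQuotient.
Variables (K : pzRingType) (V : lmodType K).

Definition submod_pred (W : submodClosed V) : V -> bool := fun x => x \in W.

HB.instance Definition _ (W : submodClosed V) :=
  GRing.isSubmodClosed.Build K V (submod_pred W) (GRing.subsemimodClosedP W).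

Variable W : submodClosed V.

Definition submod_zmod : zmodClosed V :=
  GRing.ZmodClosed.clone V (submod_pred W) _.

Definition lmod_quot : Type := Quotient.quot submod_zmod.

HB.instance Definition _ := GRing.Zmodule.on lmod_quot.

Definition lmod_proj (x : V) : lmod_quot := \pi_(Quotient.quot submod_zmod) x.

Definition quot_scale (c : K) (q : lmod_quot) : lmod_quot :=
  lmod_proj (c *: repr q).

Lemma lmod_projE x y : lmod_proj x = lmod_proj y <-> x - y \in W.
Proof.
have := Quotient.idealrBE submod_zmod x y.
by rewrite /= => ->; split=> /eqP.
Qed.

Lemma quot_scaleE c x : quot_scale c (lmod_proj x) = lmod_proj (c *: x).
Proof.
apply/lmod_projE; rewrite -scalerBr.
apply: rpredZ; apply/lmod_projE.
by rewrite /lmod_proj reprK.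
Qed.

Lemma lmod_projD x y : lmod_proj (x + y) = lmod_proj x + lmod_proj y.
Proof. by rewrite /lmod_proj !piE. Qed.

Lemma lmod_proj_surj (q : lmod_quot) : exists x, q = lmod_proj x.
Proof. by exists (repr q); rewrite /lmod_proj reprK. Qed.

Fact quot_scaleA a b q : quot_scale a (quot_scale b q) = quot_scale (a * b) q.
Proof. by have [x ->] := lmod_proj_surj q; rewrite !quot_scaleE scalerA. Qed.

Fact quot_scale1 : left_id 1 quot_scale.
Proof. by move=> q; have [x ->] := lmod_proj_surj q; rewrite quot_scaleE scale1r. Qed.

Fact quot_scaleDr : right_distributive quot_scale +%R.
Proof.
move=> c q r; have [x ->] := lmod_proj_surj q; have [y ->] := lmod_proj_surj r.
by rewrite -lmod_projD !quot_scaleE -lmod_projD scalerDr.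
Qed.

Fact quot_scaleDl q : {morph quot_scale^~ q : a b / a + b}.
Proof.
move=> a b; have [x ->] := lmod_proj_surj q.
by rewrite !quot_scaleE -lmod_projD scalerDl.
Qed.

HB.instance Definition _ := GRing.Zmodule_isLmodule.Build K lmod_quot
  quot_scaleA quot_scale1 quot_scaleDr quot_scaleDl.

End LmodQuotient.

(* The union of the sets L_n over all n, as an inductive type:
   [base] is Y + Omega(L(Y)), [Der i b] is the formal symbol D^i(b), and [word]
   is the set of nonempty sequences of letters. *)
Section Words.
Local Open Scope nat_scope.
Variables (O : Type) (ar : O -> nat) (Y : Type).

Inductive base : Type :=
| Var of Y
| Op (theta : O) of 'I_(ar theta) -> word
with letter : Type :=
| Der of nat & base
with word : Type :=
| Sing of letter
| Cons of letter & word.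

Fixpoint bre (u : word) : nat :=
  match u with Sing _ => 1 | Cons _ v => (bre v).+1 end.

Fixpoint cat_word (u v : word) : word :=
  match u with
  | Sing a => Cons a v
  | Cons a u' => Cons a (cat_word u' v)
  end.

Fixpoint degB (b : base) : nat :=
  match b with
  | Var _ => 0
  | Op theta us => (\sum_(i < ar theta) degW (us i)).+1
  end
with degL (a : letter) : nat :=
  match a with Der _ b => degB b end
with degW (u : word) : nat :=
  match u with
  | Sing a => degL a
  | Cons a v => degL a + degW v
  end.

End Words.

Arguments Var {O ar Y}.
Arguments Op {O ar Y}.
Arguments Der {O ar Y}.
Arguments Sing {O ar Y}.
Arguments Cons {O ar Y}.

HB.instance Definition _ (O : Type) (ar : O -> nat) (Y : Type) :=
  gen_eqMixin (base ar Y).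
HB.instance Definition _ (O : Type) (ar : O -> nat) (Y : Type) :=
  gen_choiceMixin (base ar Y).
HB.instance Definition _ (O : Type) (ar : O -> nat) (Y : Type) :=
  gen_eqMixin (letter ar Y).
HB.instance Definition _ (O : Type) (ar : O -> nat) (Y : Type) :=
  gen_choiceMixin (letter ar Y).
HB.instance Definition _ (O : Type) (ar : O -> nat) (Y : Type) :=
  gen_eqMixin (word ar Y).
HB.instance Definition _ (O : Type) (ar : O -> nat) (Y : Type) :=
  gen_choiceMixin (word ar Y).

(* The star is [None]. *)
Section StarWords.
Local Open Scope nat_scope.
Variables (O : Type) (ar : O -> nat) (X : Type).

Fixpoint starsB (b : base ar (option X)) : nat :=
  match b with
  | Var y => if y is None then 1 else 0
  | Op theta us => \sum_(i < ar theta) starsW (us i)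
  end
with starsL (a : letter ar (option X)) : nat :=
  match a with Der _ b => starsB b end
with starsW (u : word ar (option X)) : nat :=
  match u with
  | Sing a => starsL a
  | Cons a v => starsL a + starsW v
  end.

Definition star_word : Type := {u : word ar (option X) | starsW u == 1}.

End StarWords.

Section WordOrder.
Variables (dO dX : Order.disp_t) (O : orderType dO) (ar : O -> nat).
Variable (X : orderType dX).

(* One step of a lexicographic comparison: [rest] decides when a = b. *)
Definition lex_step (T : eqType) (lt : rel T) (a b : T) (rest : bool) : bool :=
  lt a b || (a == b) && rest.

Definition deg_bre_lex (u v : word ar X) (rest : bool) : bool :=
  lex_step ltn (degW u) (degW v) (lex_step ltn (bre u) (bre v) rest).

(* [lex_word] compares the sequences of letters of two words of equal breadth, so
   that its values on words of different breadths are irrelevant. In [lt_base],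
   the arguments of two terms with the same operator symbol are compared
   through the values of their indices, since the arities [ar theta] and
   [ar delta] are not convertible: k is the first index where they differ. *)
Fixpoint lt_base (b c : base ar X) : bool :=
  match b, c with
  | Var x, Var y => (x < y)%O
  | Var _, Op _ _ => true
  | Op _ _, Var _ => false
  | Op theta us, Op delta vs =>
      lex_step ltn (degB b) (degB c)
        (lex_step (fun t d : O => (t < d)%O) theta delta
          [exists k : 'I_(ar theta), exists l : 'I_(ar delta),
            [&& k == l :> nat,
                deg_bre_lex (us k) (vs l) (lex_word (us k) (vs l)) &
                [forall i : 'I_(ar theta), forall j : 'I_(ar delta),
                  (i == j :> nat) && (i < k)%N ==> (us i == vs j)]]])
  end
with lt_letter (a a' : letter ar X) : bool :=
  match a, a' with
  | Der i b, Der j c =>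
      lex_step ltn (degB b) (degB c) (lex_step ltn i j (lt_base b c))
  end
with lex_word (u v : word ar X) : bool :=
  match u, v with
  | Sing a, Sing a' => lt_letter a a'
  | Cons a u', Cons a' v' => lex_step lt_letter a a' (lex_word u' v')
  | _, _ => false
  end.

Definition lt_word (u v : word ar X) : bool := deg_bre_lex u v (lex_word u v).

End WordOrder.

(* The underlying vector space of the free algebra D<X;Omega>. *)
Notation DXO ar X K := {malg K[word ar X]}.

Section FreeAlgebra.
Variables (dO dX : Order.disp_t) (O : orderType dO) (ar : O -> nat).
Variables (X : orderType dX) (K : fieldType) (lam : K).

Local Notation A := (DXO ar X K).

Definition mono (w : word ar X) : A := << w >>.

Definition lin_ext (h : word ar X -> A) (f : A) : A :=
  \sum_(u <- msupp f) f@_u *: h u.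

(* The library's ring structures on [{malg _}] require a unital monoid. *)
Definition amul (f g : A) : A :=
  lin_ext (fun u => lin_ext (fun v => mono (cat_word u v)) g) f.

Local Notation "f ** g" := (amul f g) (at level 40, left associativity).

Fixpoint derW (u : word ar X) : A :=
  match u with
  | Sing (Der i b) => mono (Sing (Der i.+1 b))
  | Cons (Der i b) v =>
      let Da := mono (Sing (Der i.+1 b)) in
      lam *: (Da ** derW v) + Da ** mono v + mono (Sing (Der i b)) ** derW v
  end.

Definition der : A -> A := lin_ext derW.

(* All the arguments are expanded over the union B of their supports. *)
Definition op (theta : O) (fs : 'I_(ar theta) -> A) : A :=
  let B : {fset word ar X} := (\bigcup_(i in 'I_(ar theta)) msupp (fs i))%fset in
  \sum_(v : {ffun 'I_(ar theta) -> B})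
     (\prod_(i < ar theta) (fs i)@_(val (v i)))
       *: mono (Sing (Der 0 (Op theta (fun i => val (v i))))).

Fixpoint substB (b : base ar (option X)) (s : A) : A :=
  match b with
  | Var y => if y is Some x then mono (Sing (Der 0 (Var x))) else s
  | Op theta us => @op theta (fun i => substW (us i) s)
  end
with substL (a : letter ar (option X)) (s : A) : A :=
  match a with Der i b => iter i der (substB b s) end
with substW (u : word ar (option X)) (s : A) : A :=
  match u with
  | Sing a => substL a s
  | Cons a v => substL a s ** substW v s
  end.

Definition subst (u : star_word ar X) (s : A) : A := substW (val u) s.

(* [None] exactly when f = 0. *)
Definition leadw (f : A) : option (word ar X) :=
  omap val [pick w : msupp f |
              [forall v : msupp f, (v == w) || lt_word (val v) (val w)]].

(* The leading word as an element of the algebra, 0 when f = 0. *)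
Definition lm (f : A) : A := if leadw f is Some w then mono w else 0.

Definition lc (f : A) : K := if leadw f is Some w then f@_w else 0.

Definition bre_lead (f : A) : nat := if leadw f is Some w then bre w else 0%N.

Definition is_monic (f : A) : Prop := lc f = 1.

Definition is_ideal (I : A -> Prop) : Prop :=
  [/\ [/\ I 0, forall f g, I f -> I g -> I (f + g) &
          forall c f, I f -> I (c *: f)],
      forall f g, I f -> I (f ** g) /\ I (g ** f),
      forall f, I f -> I (der f) &
      forall theta (fs : 'I_(ar theta) -> A) i, I (fs i) -> I (@op theta fs)].

Definition Id (S : A -> Prop) (f : A) : Prop :=
  forall I, is_ideal I -> (forall s, S s -> I s) -> I f.

Definition Idp (S : A -> Prop) : {pred A} := fun f => `[< Id S f >].

Fact Idp_submod_closed S : submod_closed (Idp S).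
Proof.
split; first by apply/asboolP => I [[]].
move=> c f g /asboolP If /asboolP Ig; apply/asboolP => I HI HS.
by case: (HI) => [[_ HD HZ] _ _ _]; apply: HD; [apply: HZ; apply: If | apply: Ig].
Qed.

HB.instance Definition _ S :=
  GRing.isSubmodClosed.Build K A (Idp S) (Idp_submod_closed S).

Definition Id_submod (S : A -> Prop) : submodClosed A :=
  GRing.SubmodClosed.clone K A (Idp S) _.

Definition quotDXO (S : A -> Prop) : lmodType K := lmod_quot (Id_submod S).

Definition quot_proj (S : A -> Prop) (f : A) : quotDXO S :=
  lmod_proj (Id_submod S) f.

Definition normal (u : star_word ar X) (s : A) : Prop :=
  lm (subst u s) = subst u (lm s).

(* [composition f g w h]: h is a composition (f,g)_w. *)
Inductive composition (f g : A) : word ar X -> A -> Prop :=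
| Intersection (i j : nat) (a b w : word ar X) of
    mono w = lm (iter i der f) ** mono a &
    mono w = mono b ** lm (iter j der g) &
    (bre w < bre_lead f + bre_lead g)%N :
    composition f g w
      ((lc (iter i der f))^-1 *: (iter i der f ** mono a)
       - (lc (iter j der g))^-1 *: (mono b ** iter j der g))
| Including (i j : nat) (u : star_word ar X) (w : word ar X) of
    mono w = lm (iter i der f) &
    mono w = subst u (lm (iter j der g)) :
    composition f g w
      ((lc (iter i der f))^-1 *: iter i der f
       - (lc (iter j der g))^-1 *: subst u (iter j der g)).

Definition equiv_mod (S : A -> Prop) (w : word ar X) (p q : A) : Prop :=
  exists (n : nat) (alpha : 'I_n -> K) (u : 'I_n -> star_word ar X)
         (s : 'I_n -> A) (l : 'I_n -> nat),
    p - q = \sum_(k < n) alpha k *: subst (u k) (iter (l k) der (s k)) /\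
    forall k, [/\ S (s k), normal (u k) (iter (l k) der (s k)) &
      exists2 v, subst (u k) (lm (iter (l k) der (s k))) = mono v & lt_word v w].

Definition GS_basis (S : A -> Prop) : Prop :=
  forall f g w h, S f -> S g -> composition f g w h -> equiv_mod S w h 0.

Definition Irr (S : A -> Prop) (w : word ar X) : Prop :=
  forall s i (u : star_word ar X), S s -> normal u (iter i der s) ->
    mono w <> subst u (lm (iter i der s)).

End FreeAlgebra.

(* Main.v *)
From mathcomp Require Import all_boot all_order all_algebra.
From mathcomp Require Import finmap boolp.
From mathcomp.multinomials Require Import monalg.
Require Import Defs.

Set Implicit Arguments.
Unset Strict Implicit.
Unset Printing Implicit Defensive.

Import Order.TTheory GRing.Theory.

Local Open Scope ring_scope.

(** The theorem is a confluence statement. An element [s] of [S] is read as the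
    rewriting rule that replaces its leading word by the opposite of the rest;
    the three conditions say that rewriting gives every element a unique
    irreducible form modulo [Id S]. Rewriting terminates because the order on
    words is well founded ([lt_word_wf]), so all depends on two rules that
    apply to the same word.

    Two facts tame the derivation. First, the leading word of [D(f)] is the image
    of the leading word of [f] under a strictly increasing map [der_lead], with a
    coefficient multiplied by a power of [lam], or by 1 when [lam = 0]
    ([haslead_der]). Second, a star word whose star stands under [D^j] evaluates
    at [s] like a context [phi] with no derivation directly over its hole,
    evaluated at [D^j(s)] ([star_ctx]). So, up to a scalar, the normal s-words
    are the elements [phi[D^l(s)]] for such contexts [phi] ([term], [star_term],
    [term_star]). A context [phi] is just a strictly increasing map on words
    ([isctx], [lt_ctx]) extended linearly ([cmap]), and the leading word of
    [phi[f]] is therefore [phi] of the leading word of [f].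

    The terms span [Id S] ([IdP]): the product rule and multilinearity show that
    their span is closed under all the operations.

    (I) implies (II). Suppose two terms have the same leading word [w]. Two
    occurrences inside [w] are disjoint, nested, or overlap at their ends
    ([ctx_overlap]). In the first case the two factors can be replaced one
    after the other ([disjoint_terms]); in the other cases the difference of the
    terms is a composition placed in a context. In each case it is a combination
    of terms with leading words below [w] ([confluence]). Hence a combination of
    terms can be rewritten so that its largest leading word occurs only once
    ([below_terms_top]); if it is not cancelled it is the leading word of the
    sum, and otherwise one goes on with a smaller word ([below_terms_lead]).

    (II) implies (III). Irreducible words span the quotient by termination
    ([reduction]), and a nonzero combination of them in [Id S] would have a
    leading word that is both reducible and irreducible ([leading_irr_basis]).

    (III) implies (I). A composition [(f,g)_w] lies in [Id S] and below [w].
    Reducing it leaves a combination of irreducible words in [Id S], which is 0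
    by independence, so the composition is a combination of terms below [w]
    ([irr_basis_GS]). *)

(** * The order on words *)

Scheme base_mut := Induction for base Sort Prop
  with letter_mut := Induction for letter Sort Prop
  with word_mut := Induction for word Sort Prop.
Combined Scheme base_letter_word_ind from base_mut, letter_mut, word_mut.

Section Order.
Local Open Scope nat_scope.

Lemma lex_stepP (T : eqType) (lt : rel T) (a b : T) (rest : bool) :
  reflect (lt a b \/ a = b /\ rest) (lex_step lt a b rest).
Proof.
rewrite /lex_step; apply: (iffP orP) => -[h|h]; [by left| |by left|].
  by case/andP: h => /eqP ? ?; right.
by case: h => -> ->; right; rewrite eqxx.
Qed.

Definition first_diff (T : Type) (lt : rel T) (n : nat) (us vs : 'I_n -> T) : Prop :=
  exists k, lt (us k) (vs k) /\ forall i : 'I_n, i < k -> us i = vs i.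

Variables (dO dX : Order.disp_t) (O : orderType dO) (ar : O -> nat).
Variable (X : orderType dX).
Local Notation word := (word ar X).
Local Notation base := (base ar X).
Local Notation letter := (letter ar X).
Implicit Types (u v w : word) (b c d : base) (x y z : letter).

Lemma Op_inj t (us vs : 'I_(ar t) -> word) : Op t us = Op t vs -> us = vs.
Proof.
case=> e.
(* Injectivity gives an equality of dependent pairs over the eqType [O]. *)
pose P t0 := 'I_(ar t0) -> word.
have := congr1 (fun w : {t0 & P t0} => tagged_as (Tagged P us) w) e.
by rewrite !tagged_asE.
Qed.

Lemma lt_wordE u v :
  lt_word u v <-> degW u < degW v \/ degW u = degW v /\
     (bre u < bre v \/ bre u = bre v /\ lex_word u v).
Proof.
split; first by move/lex_stepP => [|[-> /lex_stepP]]; intuition.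
move=> h; apply/lex_stepP; case: h => [|[e h]]; [by left|right; split=> //].
exact/lex_stepP.
Qed.

Lemma lt_letterE i b j c :
  lt_letter (Der i b) (Der j c) <-> degB b < degB c \/ degB b = degB c /\
     (i < j \/ i = j /\ lt_base b c).
Proof.
split; first by move/lex_stepP => [|[-> /lex_stepP]]; intuition.
move=> h; apply/lex_stepP; case: h => [|[e h]]; [by left|right; split=> //].
exact/lex_stepP.
Qed.

(** Once the symbols agree, comparing operands through the values of their indices
    is a lexicographic comparison of two families over the same ordinal. The
    next lemmas package this fact without the cast. *)
Lemma lt_base_opE t (us : 'I_(ar t) -> word) t' (vs : 'I_(ar t') -> word) :
  lt_base (Op t us) (Op t' vs) <->
    degB (Op t us) < degB (Op t' vs) \/ degB (Op t us) = degB (Op t' vs) /\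
     ((t < t')%O \/ exists e : t = t',
        first_diff (@lt_word _ _ O ar X) us (fun i => vs (cast_ord (congr1 ar e) i))).
Proof.
have step : t = t' ->
  [exists k : 'I_(ar t), exists l : 'I_(ar t'),
            [&& k == l :> nat,
                deg_bre_lex (us k) (vs l) (lex_word (us k) (vs l)) &
                [forall i : 'I_(ar t), forall j : 'I_(ar t'),
                  (i == j :> nat) && (i < k)%N ==> (us i == vs j)]]]
   <-> exists e : t = t',
        first_diff (@lt_word _ _ O ar X) us (fun i => vs (cast_ord (congr1 ar e) i)).
  move=> e; split.
    move=> /existsP [k /existsP [l /and3P [/eqP kl lt1 /forallP h]]].
    exists e; exists k; split.
      by rewrite (_ : cast_ord _ _ = l) //; apply: val_inj.
    move=> i ik; have /forallP/(_ (cast_ord (congr1 ar e) i)) := h i.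
    by rewrite /= eqxx ik => /eqP.
  case=> e' [k [lt1 h]]; apply/existsP; exists k; apply/existsP.
  exists (cast_ord (congr1 ar e') k); rewrite /= eqxx /=; apply/andP; split=> //.
  apply/forallP => i; apply/forallP => j; apply/implyP => /andP [/eqP ij ik].
  by apply/eqP; rewrite (h _ ik); congr vs; apply: val_inj.
split.
  move/lex_stepP => [|[-> /lex_stepP]]; first by left.
  by move=> [|[tt' h]]; [right; split; [|left]|right; split=> //; right; apply/step].
move=> h; apply/lex_stepP; case: h => [|[e h]]; [by left|right; split=> //].
apply/lex_stepP; case: h => [|[e' h]]; [by left|right; split=> //].
by apply/step=> //; exists e'.
Qed.

Lemma lt_base_sameE t (us vs : 'I_(ar t) -> word) :
  lt_base (Op t us) (Op t vs) <->
    degB (Op t us) < degB (Op t vs) \/ degB (Op t us) = degB (Op t vs) /\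
      first_diff (@lt_word _ _ O ar X) us vs.
Proof.
have cE (e : t = t) : (fun i => vs (cast_ord (congr1 ar e) i)) = vs.
  by apply: funext => i; congr vs; apply: val_inj.
rewrite lt_base_opE ltxx; split.
  by case=> [|[e [//|[e']]]]; [left|rewrite cE; right].
case=> [|[? h]]; [by left|right; split=> //; right].
by exists erefl; rewrite cE.
Qed.

Lemma bre_gt0 u : 0 < bre u.
Proof. by case: u. Qed.

Lemma lt_base_deg b c : lt_base b c -> degB b <= degB c.
Proof.
case: b c => [x|t us] [y|t' vs] //.
by move/lt_base_opE => [/ltnW|[->]].
Qed.

(** The existential form makes case analysis on the second argument possible
    without transporting operands along an equality of symbols. *)
Lemma lt_base_opP t (us : 'I_(ar t) -> word) c :
  lt_base (Op t us) c <->
    degB (Op t us) < degB c \/ degB (Op t us) = degB c /\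
      ((exists t' vs, c = Op t' vs /\ (t < t')%O) \/
       exists vs, c = Op t vs /\ first_diff (@lt_word _ _ O ar X) us vs).
Proof.
case: c => [y|t' vs].
  by split=> // -[//|[//]].
rewrite lt_base_opE; split=> -[h|[ed h]]; [by left|right|by left|right]; split=> //.
  case: h => [h|[e]]; first by left; exists t', vs.
  case: t' / e vs ed => vs ed h; right; exists vs; split=> //.
  by move: h; rewrite (_ : (fun i => _) = vs) //; apply: funext => i; congr vs; apply: val_inj.
case: h => [[t1 [vs1 [[e _] lt1]]]|[vs1 [e h]]]; first by left; rewrite e.
right; have et : t = t' by case: e.
case: t' / et vs ed e => vs ed e; exists erefl; rewrite (Op_inj e).
by rewrite (_ : (fun i => _) = vs1) //; apply: funext => i; congr vs1; apply: val_inj.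
Qed.

(** The order is defined by mutual recursion, so irreflexivity, transitivity and
    totality are proved for base elements, letters and words together. The
    statements on words concern [lex_word] only; the preliminary comparison of
    degree and breadth is added afterwards. *)
Lemma lt_irr_all :
  (forall b, ~~ lt_base b b) /\ (forall x, ~~ lt_letter x x) /\
  (forall u, ~~ lex_word u u).
Proof.
apply: base_letter_word_ind => //= [x|t us IH|i b IH|x IHx u IHu].
- by rewrite ltxx.
- apply/negP => /lt_base_sameE [|[_ [k [/lt_wordE + _]]]]; rewrite ?ltnn //.
  by case=> [|[_ [|[_]]]]; rewrite ?ltnn // (negPf (IH k)).
- by rewrite /lex_step /= !ltnn (negPf IH) !andbF.
- by rewrite /lex_step (negPf IHx) (negPf IHu) andbF.
Qed.

Lemma lt_word_irr u : lt_word u u = false.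
Proof.
by rewrite /lt_word /deg_bre_lex /lex_step /= !ltnn (negPf (lt_irr_all.2.2 u)) !andbF.
Qed.

Lemma lt_word_trans_of u v w :
  (lex_word u v -> lex_word v w -> lex_word u w) ->
  lt_word u v -> lt_word v w -> lt_word u w.
Proof.
move=> tr /lt_wordE [d1|[d1 h1]] /lt_wordE [d2|[d2 h2]]; apply/lt_wordE.
- by left; apply: ltn_trans d1 d2.
- by left; rewrite -d2.
- by left; rewrite d1.
right; split; first by rewrite d1.
case: h1 h2 => [b1|[b1 l1]] [b2|[b2 l2]].
- by left; apply: ltn_trans b1 b2.
- by left; rewrite -b2.
- by left; rewrite b1.
by right; split; [rewrite b1|apply: tr].
Qed.

Lemma lt_trans_all :
  (forall b c d, lt_base b c -> lt_base c d -> lt_base b d) /\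
  (forall x y z, lt_letter x y -> lt_letter y z -> lt_letter x z) /\
  (forall u v w, lex_word u v -> lex_word v w -> lex_word u w).
Proof.
apply: base_letter_word_ind => [x|t us IH|i b IH|x IH|x IHx u IHu].
- by move=> [y|t us] [z|t' vs] //=; apply: lt_trans.
- move=> c d /lt_base_opP [lt1 /lt_base_deg le2|[e1 h1] lt2]; apply/lt_base_opP.
    by left; apply: leq_trans lt1 le2.
  case: h1 => [[t' [vs [ec tt']]]|[vs [ec h1]]]; subst c;
    case/lt_base_opP: lt2 => [lt2|[e2 h2]]; try (by left; rewrite e1); right;
    (split; first by rewrite e1).
    left; case: h2 => [[t2 [ws [-> tt2]]]|[ws [-> _]]].
      by exists t2, ws; split=> //; apply: lt_trans tt2.
    by exists t', ws.
  case: h2 => [[t2 [ws [-> tt2]]]|[ws [-> h2]]]; first by left; exists t2, ws.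
  right; exists ws; split=> //.
  case: h1 h2 => [k1 [lt1 h1]] [k2 [lt2 h2]].
  case: (ltngtP k1 k2) => k12.
  + exists k1; split; first by rewrite -(h2 _ k12).
    by move=> i ik; rewrite h1 // h2 //; apply: ltn_trans k12.
  + exists k2; split; first by rewrite (h1 _ k12).
    by move=> i ik; rewrite h1 ?h2 //; apply: ltn_trans k12.
  + have ek : k1 = k2 by apply: val_inj.
    subst k2; exists k1; split.
      by apply: lt_word_trans_of lt1 lt2; apply: IH.
    by move=> i ik; rewrite h1 ?h2.
- move=> [j c] [k d] /lt_letterE [d1|[d1 h1]] /lt_letterE [d2|[d2 h2]]; apply/lt_letterE.
  + by left; apply: ltn_trans d1 d2.
  + by left; rewrite -d2.
  + by left; rewrite d1.
  right; split; first by rewrite d1.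
  case: h1 h2 => [b1|[b1 l1]] [b2|[b2 l2]].
  + by left; apply: ltn_trans b1 b2.
  + by left; rewrite -b2.
  + by left; rewrite b1.
  by right; split; [rewrite b1|apply: IH l2].
- by move=> [y|y v] [z|z w] //=; apply: IH.
- move=> [y|y v] [z|z w] //= /lex_stepP [l1|[-> l1]] /lex_stepP [l2|[<- l2]]; apply/lex_stepP.
  + by left; apply: IHx l2.
  + by left.
  + by left.
  + by right; split=> //; apply: IHu l2.
Qed.

Lemma lt_word_trans u v w : lt_word u v -> lt_word v w -> lt_word u w.
Proof. by apply: lt_word_trans_of; apply: lt_trans_all.2.2. Qed.

Lemma lt_word_total_of u v :
  (bre u = bre v -> [\/ u = v, lex_word u v | lex_word v u]) ->
  [\/ u = v, lt_word u v | lt_word v u].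
Proof.
move=> tot; case: (ltngtP (degW u) (degW v)) => hd.
- by constructor 2; apply/lt_wordE; left.
- by constructor 3; apply/lt_wordE; left.
case: (ltngtP (bre u) (bre v)) => hb.
- by constructor 2; apply/lt_wordE; right; split=> //; left.
- by constructor 3; apply/lt_wordE; right; split=> //; left.
case: (tot hb) => h; first by constructor 1.
- by constructor 2; apply/lt_wordE; right; split=> //; right.
- by constructor 3; apply/lt_wordE; right; split=> //; right.
Qed.

(** Totality holds for [lex_word] on words of the same breadth only, which is
    the only case where [lt_word] consults it. *)
Lemma lt_total_all :
  (forall b c, [\/ b = c, lt_base b c | lt_base c b]) /\
  (forall x y, [\/ x = y, lt_letter x y | lt_letter y x]) /\
  (forall u v, bre u = bre v -> [\/ u = v, lex_word u v | lex_word v u]).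
Proof.
apply: base_letter_word_ind => [x|t us IH|i b IH|x IH|x IHx u IHu].
- move=> [y|t us] /=; last by constructor 2.
  by case: (ltgtP x y) => [||->]; [constructor 2|constructor 3|constructor 1].
- move=> [y|t' vs]; first by constructor 3.
  case: (ltngtP (degB (Op t us)) (degB (Op t' vs))) => hd.
  + by constructor 2; apply/lt_base_opP; left.
  + by constructor 3; apply/lt_base_opP; left.
  case: (ltgtP t t') => ht.
  + by constructor 2; apply/lt_base_opP; right; split=> //; left; exists t', vs.
  + by constructor 3; apply/lt_base_opP; right; split=> //; left; exists t, us.
  subst t'; have [->|ne] := pselect (us = vs); first by constructor 1.
  have [k0 k0P] : exists k, us k != vs k.
    apply/not_existsP => h; apply: ne; apply: funext => k.
    by apply/eqP; apply: contra_notT (h k).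
  case: (@arg_minnP _ k0 (fun k => us k != vs k) val k0P) => k kP kmin.
  have hk : forall i : 'I_(ar t), i < k -> us i = vs i.
    by move=> i; rewrite ltnNge => /negP ik; apply/eqP; apply: contra_notT ik; apply: kmin.
  case: (lt_word_total_of (IH k (vs k))) => h; first by rewrite h eqxx in kP.
  + by constructor 2; apply/lt_base_sameE; right; split=> //; exists k.
  + constructor 3; apply/lt_base_sameE; right; split=> //; exists k; split=> //.
    by move=> i /hk.
- move=> [j c]; case: (ltngtP (degB b) (degB c)) => hd.
  + by constructor 2; apply/lt_letterE; left.
  + by constructor 3; apply/lt_letterE; left.
  case: (ltngtP i j) => hb.
  + by constructor 2; apply/lt_letterE; right; split=> //; left.
  + by constructor 3; apply/lt_letterE; right; split=> //; left.
  case: (IH c) => h; first by constructor 1; rewrite hb h.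
  + by constructor 2; apply/lt_letterE; right; split=> //; right.
  + by constructor 3; apply/lt_letterE; right; split=> //; right.
- move=> [y|y v] h0; last by case: h0 => h0; have := bre_gt0 v; rewrite -h0.
  case: (IH y) => /= h; [by constructor 1; rewrite h|by constructor 2|by constructor 3].
- move=> [y|y v] [h0]; first by have := bre_gt0 u; rewrite h0.
  have hu := IHu _ h0; case: (IHx y) => /= h.
  + case: hu => h'; first by constructor 1; rewrite h h'.
      by constructor 2; apply/lex_stepP; right.
    by constructor 3; apply/lex_stepP; right.
  + by constructor 2; apply/lex_stepP; left.
  + by constructor 3; apply/lex_stepP; left.
Qed.

Lemma lt_word_total u v : [\/ u = v, lt_word u v | lt_word v u].
Proof. by apply: lt_word_total_of; apply: lt_total_all.2.2. Qed.

End Order.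

(** * Well-foundedness of the order *)

Section WellFounded.
Local Open Scope nat_scope.

(** Well-foundedness relative to a subset, in the form of minimal elements: a
    lexicographic order is then treated by minimising the components one after
    the other. *)
Definition wf_on (U : Type) (D : U -> Prop) (R : U -> U -> Prop) : Prop :=
  forall P : U -> Prop, (forall x, P x -> D x) -> (exists x, P x) ->
    exists x, P x /\ forall y, P y -> ~ R y x.

Lemma wf_on_well_founded U (D : U -> Prop) (R : U -> U -> Prop) :
  well_founded R -> wf_on D R.
Proof.
move=> wfR P _ [x Px]; apply: contrapT => nomin.
elim/(well_founded_ind wfR): x Px => x IH Px; apply: nomin; exists x; split=> // y Py Ryx.
exact: IH Ryx Py.
Qed.

Lemma wf_on_lex U T (D : U -> Prop) (E : T -> Prop) (m : U -> T)
    (lt : T -> T -> Prop) (R R' : U -> U -> Prop) :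
  (forall u, D u -> E (m u)) -> wf_on E lt ->
  (forall u v, D u -> D v -> R u v -> lt (m u) (m v) \/ m u = m v /\ R' u v) ->
  (forall t, E t -> wf_on (fun u => D u /\ m u = t) R') ->
  wf_on D R.
Proof.
move=> DE wfE RR' wfR' P PD [x0 Px0].
have [||t [[x Px <-] tmin]] := wfE (fun t => exists2 x, P x & m x = t).
- by move=> t [x Px <-]; apply/DE/PD.
- by exists (m x0), x0.
have [||y [[Py my] ymin]] := wfR' (m x) (DE _ (PD _ Px)) (fun u => P u /\ m u = m x).
- by move=> u [/PD].
- by exists x.
exists y; split=> // z Pz Rzy; have [|[e h]] := RR' _ _ (PD _ Pz) (PD _ Py) Rzy.
  by rewrite my; apply: tmin; exists z.
by apply: ymin h; rewrite e.
Qed.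

Lemma wf_on_image U T (D : U -> Prop) (E : T -> Prop) (g : T -> U)
    (lt : T -> T -> Prop) (R : U -> U -> Prop) :
  wf_on E lt -> (forall u, D u -> exists2 t, E t & u = g t) ->
  (forall s t, E s -> E t -> R (g s) (g t) -> lt s t) -> wf_on D R.
Proof.
move=> wfE DE Rlt P PD [x Px].
have [||t [[Et Pt] tmin]] := wfE (fun t => E t /\ P (g t)).
- by move=> t [].
- by have [t Et e] := DE _ (PD _ Px); exists t; rewrite -e.
exists (g t); split=> // y Py Ry; have [s Es e] := DE _ (PD _ Py); subst y.
exact: (tmin s (conj Es Py) (Rlt _ _ Es Et Ry)).
Qed.

(** Induction on the arity: minimise the first operand, then the others. *)
Lemma wf_on_first_diff T (E : T -> Prop) (lt : rel T) n :
  wf_on E lt -> wf_on (fun us : 'I_n -> T => forall i, E (us i)) (@first_diff _ lt n).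
Proof.
move=> wfE; elim: n => [|n IH].
  by move=> P _ [us Pus]; exists us; split=> // vs _ [[]].
apply: (@wf_on_lex _ _ _ E (fun us => us ord0) lt _
  (fun us vs => first_diff lt (us \o lift ord0) (vs \o lift ord0))) => //.
- move=> us vs _ _ [k]; case: (unliftP ord0 k) => [j|] -> [lt1 h]; last by left.
  right; split; first exact: h.
  by exists j; split=> // i ij; apply: h; rewrite /= /bump /= !add1n ltnS.
move=> t Et.
have g_lift (us : 'I_n.+1 -> T) :
    us = (fun i => if unlift ord0 i is Some j then (us \o lift ord0) j else us ord0).
  by apply: funext => i; case: unliftP => [j|] ->.
apply: (@wf_on_image _ _ _ _
  (fun us i => if unlift ord0 i is Some j then us j else t) _ _ IH).
  move=> us [Eus <-]; exists (us \o lift ord0); first by move=> i; apply: Eus.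
  exact: g_lift.
move=> us vs _ _; rewrite (_ : _ \o _ = us); last by apply: funext => i; rewrite /= liftK.
by rewrite (_ : _ \o _ = vs) //; apply: funext => i; rewrite /= liftK.
Qed.

Variables (dO dX : Order.disp_t) (O : orderType dO) (ar : O -> nat).
Variable (X : orderType dX).
Hypothesis O_wf : well_founded (fun t d : O => (t < d)%O).
Hypothesis X_wf : well_founded (fun x y : X => (x < y)%O).
Local Notation word := (word ar X).
Local Notation base := (base ar X).
Local Notation letter := (letter ar X).

Lemma ltn_wf_on (D : nat -> Prop) : wf_on D (fun i j => i < j).
Proof.
apply: wf_on_well_founded => n; elim/ltn_ind: n => n IH.
by constructor=> m /IH.
Qed.

Definition symbol (b : base) : option O := if b is Op t _ then Some t else None.

Definition lt_symbol (t t' : option O) : Prop :=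
  match t, t' with
  | None, Some _ => True
  | Some t, Some t' => (t < t')%O
  | _, None => False
  end.

Lemma lt_symbol_wf D : wf_on D lt_symbol.
Proof.
move=> P _ [t Pt]; have [Pn|nPn] := pselect (P None).
  by exists None; split=> // -[a|] _ [].
have [||s [[_ Ps] smin]] :=
  wf_on_well_founded (D := fun=> True) O_wf (P := fun t => True /\ P (Some t)) => //.
  by case: t Pt => // t Pt; exists t.
by exists (Some s); split=> // -[t' /(conj I)/smin|].
Qed.

(** The operands of a term have smaller degree than the term, which is what makes
    the induction on the degree possible. Among terms of a given degree and
    symbol the order is the lexicographic order on a fixed number of operands. *)
Lemma wf_on_base n :
  wf_on (fun u : word => degW u < n) (@lt_word _ _ O ar X) ->
  wf_on (fun b : base => degB b <= n) (@lt_base _ _ O ar X).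
Proof.
move=> wfW.
apply: (@wf_on_lex _ _ _ (fun=> True) (@degB _ _ _) (fun i j => i < j) _
  (fun b c => degB b = degB c /\ lt_base b c)) => //; first exact: ltn_wf_on.
  move=> b c _ _ lt1; have := lt_base_deg lt1; rewrite leq_eqVlt => /orP [/eqP|]; tauto.
move=> d _.
apply: (@wf_on_lex _ _ _ (fun=> True) symbol lt_symbol _
  (fun b c => degB b = degB c /\ lt_base b c)) => //; first exact: lt_symbol_wf.
  move=> [x|t us] [y|t' vs] _ _ [ed lt1]; [by right|by left|by []|].
  case/lt_base_opP: (lt1) => [|[_ [[t1 [us1 [+ h]]]|[us1 [+ _]]]]].
  - by rewrite ed ltnn.
  - by move=> e; left; rewrite /= (_ : t' = t1) //; case: e.
  - by move/(congr1 symbol) => e; right; split.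
move=> [t|] _.
  apply: (wf_on_image (wf_on_first_diff (n := ar t) wfW) (g := Op t)).
    case=> [y|t' us] [[+ _]] //= [et]; subst t' => hd; exists us => // i.
    by apply: leq_trans hd; rewrite ltnS (bigD1 i) //= leq_addr.
  by move=> us vs _ _ [ed /lt_base_sameE]; rewrite ed ltnn => -[|[]].
apply: (wf_on_image (wf_on_well_founded X_wf (D := fun=> True)) (g := Var)).
  by case=> [y|t' us] [_] //= _; exists y.
by move=> x y _ _ [].
Qed.

Lemma wf_on_letter n :
  wf_on (fun u : word => degW u < n) (@lt_word _ _ O ar X) ->
  wf_on (fun x : letter => degL x <= n) (@lt_letter _ _ O ar X).
Proof.
move=> /wf_on_base wfB.
pose tp (x : letter) := let: Der i b := x in i.
pose bp (x : letter) := let: Der i b := x in b.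
apply: (@wf_on_lex _ _ _ (fun=> True) (@degL _ _ _) (fun i j => i < j) _
  (fun x y => tp x < tp y \/ tp x = tp y /\ lt_base (bp x) (bp y))) => //.
- exact: ltn_wf_on.
- by move=> [i b] [j c] _ _ /lt_letterE [|[]]; [left|right].
move=> d _; apply: (@wf_on_lex _ _ _ (fun=> True) tp (fun i j => i < j) _
  (fun x y => lt_base (bp x) (bp y))) => //; first exact: ltn_wf_on.
move=> i _; apply: (wf_on_image wfB (g := Der i)) => //.
by move=> [j b] [[hd _] /= <-]; exists b.
Qed.

(** The breadth has to be fixed: the lexicographic order on words of arbitrary
    length is not well founded. *)
Lemma wf_on_lex_word n t :
  wf_on (fun x : letter => degL x <= n) (@lt_letter _ _ O ar X) ->
  wf_on (fun u : word => degW u <= n /\ bre u = t) (@lex_word _ _ O ar X).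
Proof.
move=> wfL; elim: t => [|t IH]; first by move=> P PD [u /PD [_]]; case: u.
have [->|t0] := posnP t.
  apply: (wf_on_image wfL (g := Sing)) => //.
  by move=> [x|x u] [hd]; [exists x|case=> e; have := bre_gt0 u; rewrite e].
pose hd (u : word) := match u with Sing x => x | Cons x _ => x end.
pose tl (u : word) := match u with Sing x => Sing x | Cons _ v => v end.
apply: (@wf_on_lex _ _ _ (fun x => degL x <= n) hd (@lt_letter _ _ O ar X) _
  (fun u v => lex_word (tl u) (tl v))) => //.
- by move=> [x|x u] [hn _] //=; apply: leq_trans hn; apply: leq_addr.
- move=> [x|x u] [y|y v] //= _ _; first by left.
  by move=> /lex_stepP.
move=> x _; apply: (wf_on_image IH (g := Cons x)) => //.
move=> [y|y u] /= [[hn [e]] ee]; first by rewrite -e in t0.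
by exists u; rewrite -?ee //; split=> //; apply: leq_trans hn; apply: leq_addl.
Qed.

(** Induction on the bound: operands of a letter of degree at most [n] are words of
    degree below [n]. *)
Lemma wf_on_word n : wf_on (fun u : word => degW u < n) (@lt_word _ _ O ar X).
Proof.
elim: n => [|n /wf_on_letter IH]; first by move=> P PD [u /PD].
apply: (@wf_on_lex _ _ _ (fun=> True) (@degW _ _ _) (fun i j => i < j) _
  (fun u v => bre u < bre v \/ bre u = bre v /\ lex_word u v)) => //.
- exact: ltn_wf_on.
- by move=> u v _ _ /lt_wordE [|[]]; [left|right].
move=> d _; apply: (@wf_on_lex _ _ _ (fun=> True) (@bre _ _ _) (fun i j => i < j) _
  (@lex_word _ _ O ar X)) => //; first exact: ltn_wf_on.
move=> t _ P PD; apply: (wf_on_lex_word (t := t) IH).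
by move=> u /PD [[hn _] ht]; split.
Qed.

(** The words below a given word do not have a larger degree, so it is enough to
    treat words of bounded degree. *)
Lemma lt_word_wf : well_founded (fun u v : word => lt_word u v).
Proof.
move=> w; apply: contrapT => nacc.
have [||u [[hu nu] umin]] := @wf_on_word (degW w).+1
  (fun u => degW u < (degW w).+1 /\ ~ Acc (fun u v : word => lt_word u v) u).
- by move=> u [].
- by exists w.
apply: nu; constructor=> v vu; apply: contrapT => nv; apply: (umin v) (vu); split=> //.
by apply: leq_ltn_trans hu; case/lt_wordE: vu => [/ltnW|[->]].
Qed.

End WellFounded.

(** * Contexts and overlaps *)

Section Contexts.
Local Open Scope nat_scope.
Variables (dO dX : Order.disp_t) (O : orderType dO) (ar : O -> nat).
Variable (X : orderType dX).
Local Notation word := (word ar X).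
Local Notation base := (base ar X).
Local Notation letter := (letter ar X).
Implicit Types (u v w p q : word) (x y : letter) (a b : seq letter).

Lemma degW_cat u v : degW (cat_word u v) = degW u + degW v.
Proof. by elim: u => [x|x u IH] //=; rewrite IH addnA. Qed.

Lemma bre_cat u v : bre (cat_word u v) = bre u + bre v.
Proof. by elim: u => [x|x u IH] //=; rewrite IH. Qed.

Lemma cat_wordA u v w : cat_word (cat_word u v) w = cat_word u (cat_word v w).
Proof. by elim: u => [x|x u IH] //=; rewrite IH. Qed.

Fixpoint letters u : seq letter :=
  match u with Sing x => [:: x] | Cons x v => x :: letters v end.

Lemma letters_cat u v : letters (cat_word u v) = letters u ++ letters v.
Proof. by elim: u => [x|x u IH] //=; rewrite IH. Qed.

Lemma size_letters u : size (letters u) = bre u.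
Proof. by elim: u => [x|x u IH] //=; rewrite IH. Qed.

Lemma letters_inj : injective letters.
Proof.
elim=> [x|x u IH] [y|y v] /=; first by case=> ->.
- by case=> _ e; have := bre_gt0 v; rewrite -size_letters -e.
- by case=> _ e; have := bre_gt0 u; rewrite -size_letters e.
by case=> -> /IH ->.
Qed.

Lemma letters_surj a : a != [::] -> exists u, letters u = a.
Proof.
elim: a => [//|x a IH _]; case: a IH => [|y a] IH; first by exists (Sing x).
by have [//|u e] := IH; exists (Cons x u); rewrite /= e.
Qed.

Definition wrap a p b : word :=
  foldr Cons (foldl (fun w x => cat_word w (Sing x)) p b) a.

Lemma letters_wrap a p b : letters (wrap a p b) = a ++ letters p ++ b.
Proof.
rewrite /wrap; elim: a => [|x a IH] /=; last by rewrite IH.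
elim: b p => [|y b IH] p /=; first by rewrite cats0.
by rewrite IH letters_cat -catA.
Qed.

Lemma wrap_wrap a p b a' b' : wrap a (wrap a' p b') b = wrap (a ++ a') p (b' ++ b).
Proof. by apply: letters_inj; rewrite !letters_wrap !catA. Qed.

Lemma wrap_cat_l u p : cat_word u p = wrap (letters u) p [::].
Proof. by apply: letters_inj; rewrite letters_wrap letters_cat cats0. Qed.

Lemma wrap_cat_r u p : cat_word p u = wrap [::] p (letters u).
Proof. by apply: letters_inj; rewrite letters_wrap letters_cat. Qed.

Definition upd (T : Type) n (us : 'I_n -> T) (k : 'I_n) (w : T) : 'I_n -> T :=
  fun i => if i == k then w else us i.

Definition op_word i t (us : 'I_(ar t) -> word) k w : word :=
  Sing (Der i (Op t (upd us k w))).

(** One-hole contexts with no derivation directly over the hole, represented by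
    the function that fills the hole. The two constructors are a normal form:
    the hole is either a factor of the word or lies inside one of its letters.
    The analysis of overlaps compares two contexts through this form. *)
Inductive isctx : (word -> word) -> Prop :=
| ctx_flat a b : isctx (fun p => wrap a p b)
| ctx_nest a i t us k phi b : isctx phi ->
    isctx (fun p => wrap a (@op_word i t us k (phi p)) b).

Lemma isctx_ext phi psi : (forall p, phi p = psi p) -> isctx phi -> isctx psi.
Proof. by move=> e; rewrite (_ : psi = phi) //; apply: funext. Qed.

Lemma isctx_id : isctx id.
Proof. exact: (ctx_flat [::] [::]). Qed.

Lemma isctx_wrap a b phi : isctx phi -> isctx (fun p => wrap a (phi p) b).
Proof.
case=> [a' b'|a' i t us k psi b' psiP].
  by apply: (isctx_ext _ (ctx_flat (a ++ a') (b' ++ b))) => p; rewrite wrap_wrap.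
by apply: (isctx_ext _ (ctx_nest (a ++ a') i us k (b' ++ b) psiP)) => p; rewrite wrap_wrap.
Qed.

Lemma isctx_op i t us k phi : isctx phi -> isctx (fun p => @op_word i t us k (phi p)).
Proof. exact: (ctx_nest [::] _ _ _ [::]). Qed.

Lemma isctx_comp phi psi : isctx phi -> isctx psi -> isctx (phi \o psi).
Proof.
move=> phiP psiP; elim: phiP => [a b|a i t us k chi b _ IH]; first exact: isctx_wrap.
exact: ctx_nest.
Qed.

Lemma isctx_cat_l u : isctx (cat_word u).
Proof. by apply: (isctx_ext _ (ctx_flat (letters u) [::])) => p; rewrite wrap_cat_l. Qed.

Lemma isctx_cat_r u : isctx (fun p => cat_word p u).
Proof. by apply: (isctx_ext _ (ctx_flat [::] (letters u))) => p; rewrite wrap_cat_r. Qed.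

Lemma lt_cat_l u p q : lt_word p q -> lt_word (cat_word u p) (cat_word u q).
Proof.
move/lt_wordE => h; apply/lt_wordE; rewrite !degW_cat !bre_cat !ltn_add2l.
case: h => [|[-> h]]; first by left.
right; split=> //; case: h => [|[-> h]]; [by left|right; split=> //].
by elim: u => [x|x u IH] /=; apply/lex_stepP; right.
Qed.

Lemma lex_word_cat_r u p q :
  bre p = bre q -> lex_word p q -> lex_word (cat_word p u) (cat_word q u).
Proof.
elim: p q => [x|x p IH] [y|y q] //=; first by move=> _ h; apply/lex_stepP; left.
by move=> [e] /lex_stepP [h|[-> /IH h]]; apply/lex_stepP; [left|right; split; [|apply: h]].
Qed.

Lemma lt_cat_r u p q : lt_word p q -> lt_word (cat_word p u) (cat_word q u).
Proof.
move/lt_wordE => h; apply/lt_wordE; rewrite !degW_cat !bre_cat !ltn_add2r.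
case: h => [|[-> h]]; first by left.
right; split=> //; case: h => [|[e h]]; [by left|right; split; first by rewrite e].
exact: lex_word_cat_r.
Qed.

Lemma lt_wrap a b p q : lt_word p q -> lt_word (wrap a p b) (wrap a q b).
Proof.
rewrite /wrap => h; elim: a => [|x a IH] /=; last exact: (lt_cat_l (Sing x)).
by elim: b p q h => [|y b IH] p q h //=; apply: IH; apply: lt_cat_r.
Qed.

Lemma degW_op_word i t us k w :
  degW (@op_word i t us k w) = (degW w + \sum_(j < ar t | j != k) degW (us j)).+1.
Proof.
rewrite /= (bigD1 k) //= /upd eqxx; congr (_ + _).+1.
by apply: eq_bigr => j /negPf ->.
Qed.

Lemma lt_op_word i t us k p q :
  lt_word p q -> lt_word (@op_word i t us k p) (@op_word i t us k q).
Proof.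
move=> pq; apply/lt_wordE; rewrite !degW_op_word !ltnS ltn_add2r.
case/lt_wordE: (pq) => [|[e _]]; first by left.
right; split; first by rewrite e.
right; split=> //; have ed := degW_op_word i us k; rewrite /= in ed.
apply/lt_letterE; right; split; first by rewrite /= !ed e.
right; split=> //; apply/lt_base_sameE; right; split; first by rewrite /= !ed e.
exists k; rewrite /upd eqxx; split=> // j jk.
by rewrite (_ : j == k = false) //; apply/eqP => ejk; rewrite ejk ltnn in jk.
Qed.

(** The order is monomial: a context adds the same degree to both sides, and if the
    degrees agree, either the breadths or the first difference, which comes from
    the hole, decide. *)
Lemma lt_ctx phi p q : isctx phi -> lt_word p q -> lt_word (phi p) (phi q).
Proof.
move=> phiP pq; elim: phiP => [a b|a i t us k chi b _ IH]; first exact: lt_wrap.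
by apply/lt_wrap/lt_op_word.
Qed.

(** The relative positions of two occurrences [phi p = psi q] in a word: side by
    side, with a two-hole context [Pi]; one inside the other; or two factors of
    the same subword with a proper overlap, as in an intersection composition. *)
Inductive overlap (phi : word -> word) (p : word) (psi : word -> word) (q : word) : Prop :=
| Disjoint (Pi : word -> word -> word) of
    forall p', isctx (Pi p') & forall q', isctx (Pi^~ q') &
    phi = Pi^~ q & psi = Pi p
| Inside chi of isctx chi & psi = phi \o chi & p = chi q
| Around chi of isctx chi & phi = psi \o chi & q = chi p
| Cross chi u v of isctx chi & cat_word p u = cat_word v q &
    bre (cat_word p u) < bre p + bre q &
    phi = chi \o (fun r => cat_word r u) & psi = chi \o cat_word v
| CrossR chi u v of isctx chi & cat_word q u = cat_word v p &
    bre (cat_word q u) < bre q + bre p &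
    psi = chi \o (fun r => cat_word r u) & phi = chi \o cat_word v.

Lemma overlap_sym phi p psi q : overlap phi p psi q -> overlap psi q phi p.
Proof.
case=> [Pi P1 P2 e1 e2|chi c e1 e2|chi c e1 e2|chi u v c e1 lt1 e2 e3|chi u v c e1 lt1 e2 e3].
- exact: (@Disjoint _ _ _ _ (fun p q => Pi q p)).
- exact: Around c e1 e2.
- exact: Inside c e1 e2.
- exact: CrossR c e1 lt1 e2 e3.
- exact: Cross c e1 lt1 e2 e3.
Qed.

Lemma overlap_comp chi phi p psi q :
  isctx chi -> overlap phi p psi q -> overlap (chi \o phi) p (chi \o psi) q.
Proof.
move=> chiP.
case=> [Pi P1 P2 -> ->|chi' c -> ->|chi' c -> ->|chi' u v c e1 lt1 -> ->|chi' u v c e1 lt1 -> ->].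
- apply: (@Disjoint _ _ _ _ (fun p q => chi (Pi p q))) => // r.
    exact: (isctx_comp chiP (P1 r)).
  exact: (isctx_comp chiP (P2 r)).
- exact: (@Inside _ _ _ _ chi').
- exact: (@Around _ _ _ _ chi').
- by apply: (@Cross _ _ _ _ (chi \o chi')) e1 lt1 _ _ => //; apply: isctx_comp.
- by apply: (@CrossR _ _ _ _ (chi \o chi')) e1 lt1 _ _ => //; apply: isctx_comp.
Qed.

Lemma cat_eq_split (T : Type) (s1 s2 t1 t2 : seq T) :
  s1 ++ t1 = s2 ++ t2 -> size s1 <= size s2 ->
  exists r, s2 = s1 ++ r /\ t1 = r ++ t2.
Proof.
elim: s1 s2 => [|x s1 IH] [|y s2] //= e le.
- by exists [::].
- by exists (y :: s2).
- by case: e => <- /IH [//|r [-> ->]]; exists r.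
Qed.

(** When both occurrences are factors of the whole word, their relative position
    is read off the positions of the end points. If they start at the same
    place the longer one contains the other, so a proper overlap has nonempty
    parts outside both factors. *)
Lemma overlap_flat_le a1 b1 p a2 b2 q :
  wrap a1 p b1 = wrap a2 q b2 -> size a1 <= size a2 ->
  overlap (fun r => wrap a1 r b1) p (fun r => wrap a2 r b2) q.
Proof.
move=> /(congr1 letters); rewrite !letters_wrap => e le.
have [d [ea2 {}e]] := cat_eq_split e le; subst a2 => {le}.
have [le|lt1] := leqP (size (letters p)) (size d).
  have [r [ed eb1]] := cat_eq_split e le; subst d b1.
  apply: (@Disjoint _ _ _ _ (fun p' q' => wrap a1 p' (r ++ letters q' ++ b2))).
  - move=> p'; apply: (isctx_ext _ (ctx_flat (a1 ++ letters p' ++ r) b2)) => q'.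
    by apply: letters_inj; rewrite !letters_wrap !catA.
  - by move=> q'; apply: ctx_flat.
  - by [].
  by apply: funext => q'; apply: letters_inj; rewrite !letters_wrap !catA.
have [r [ep eq1]] := cat_eq_split (esym e) (ltnW lt1).
have [le|gt1] := leqP (size (letters q)) (size r).
  have [r' [er eb2]] := cat_eq_split eq1 le; subst r b2.
  apply: (@Inside _ _ _ _ (fun s => wrap d s r')); first exact: ctx_flat.
    by apply: funext => s; rewrite /comp wrap_wrap ?cats0.
  by apply: letters_inj; rewrite letters_wrap ep.
have [r' [er eb1]] := cat_eq_split (esym eq1) (ltnW gt1); subst b1.
case: (posnP (size d)) => [/size0nil ed|d0].
  subst d; rewrite cats0 /= in ep *.
  apply: (@Around _ _ _ _ (fun s => wrap [::] s r')); first exact: ctx_flat.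
    by apply: funext => s; rewrite /comp wrap_wrap ?cats0.
  by apply: letters_inj; rewrite letters_wrap er ep.
have [v ev] : exists v, letters v = d by apply: letters_surj; rewrite -size_eq0 -lt0n.
have [u eu] : exists u, letters u = r'.
  by apply: letters_surj; apply/eqP => er'; rewrite er' cats0 in er; rewrite er ltnn in gt1.
subst d r'; apply: (@Cross _ _ _ _ (fun s => wrap a1 s b2) u v); first exact: ctx_flat.
- by apply: letters_inj; rewrite !letters_cat ep er catA.
- rewrite bre_cat ltn_add2l -!size_letters er size_cat.
  move: lt1; rewrite ep size_cat -[X in X < _]addn0 ltn_add2l => lt1.
  by rewrite -[X in X < _]add0n ltn_add2r.
- by apply: funext => s; apply: letters_inj; rewrite /= !letters_wrap letters_cat !catA.
- by apply: funext => s; apply: letters_inj; rewrite /= !letters_wrap letters_cat !catA.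
Qed.

Lemma overlap_flat a1 b1 p a2 b2 q :
  wrap a1 p b1 = wrap a2 q b2 ->
  overlap (fun r => wrap a1 r b1) p (fun r => wrap a2 r b2) q.
Proof.
move=> e; have [le|lt1] := leqP (size a1) (size a2); first exact: overlap_flat_le.
by apply: overlap_sym; apply: overlap_flat_le => //; apply: ltnW.
Qed.


(** A factor and a single letter of the same word never overlap properly. Hence
    no intersection arises from a context whose hole is inside a letter. *)
Lemma wrap_eq_letter a1 b1 p a2 b2 x :
  wrap a1 p b1 = wrap a2 (Sing x) b2 ->
  [\/ exists a b, [/\ p = wrap a (Sing x) b, a2 = a1 ++ a & b2 = b ++ b1],
      exists e, a2 = a1 ++ letters p ++ e /\ b1 = e ++ x :: b2 |
      exists e, a1 = a2 ++ x :: e /\ b2 = e ++ letters p ++ b1].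
Proof.
move=> /(congr1 letters); rewrite !letters_wrap /= => e.
have [lt1|le] := ltnP (size a2) (size a1).
  have [[|y d] [ed]] := cat_eq_split (esym e) (ltnW lt1).
    by rewrite ed cats0 ltnn in lt1.
  by case=> ex eb; constructor 3; exists d; rewrite ed ex.
have [d [ed {}e]] := cat_eq_split e le.
have [le'|lt1] := leqP (size (letters p)) (size d).
  have [r [ed' eb]] := cat_eq_split e le'.
  by constructor 2; exists r; rewrite ed ed'.
have [[|y r] [er]] := cat_eq_split (esym e) (ltnW lt1).
  by rewrite er cats0 ltnn in lt1.
case=> ex eb; constructor 1; exists d, r; split=> //.
by apply: letters_inj; rewrite letters_wrap er ex.
Qed.

Lemma overlap_flat_nest a1 b1 p a2 i t us k b2 psi q :
  isctx psi -> wrap a1 p b1 = wrap a2 (@op_word i t us k (psi q)) b2 ->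
  overlap (fun r => wrap a1 r b1) p (fun r => wrap a2 (@op_word i t us k (psi r)) b2) q.
Proof.
move=> psiP /wrap_eq_letter [[a [b [ep -> ->]]]|[e [-> ->]]|[e [-> ->]]].
- apply: (@Inside _ _ _ _ (fun r => wrap a (@op_word i t us k (psi r)) b)) => //.
    exact: ctx_nest.
  by apply: funext => r /=; rewrite wrap_wrap.
- apply: (@Disjoint _ _ _ _
    (fun p' q' => wrap a1 p' (e ++ letters (@op_word i t us k (psi q')) ++ b2))) => //.
  + move=> p'; apply: (isctx_ext _ (ctx_nest (a1 ++ letters p' ++ e) i us k b2 psiP)) => q'.
    by apply: letters_inj; rewrite !letters_wrap /= -!catA.
  + by move=> q'; apply: ctx_flat.
  by apply: funext => q'; apply: letters_inj; rewrite !letters_wrap /= -!catA.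
- apply: (@Disjoint _ _ _ _
    (fun p' q' => wrap (a2 ++ letters (@op_word i t us k (psi q')) ++ e) p' b1)).
  + move=> p'; apply: (isctx_ext _ (ctx_nest a2 i us k (e ++ letters p' ++ b1) psiP)) => q'.
    by apply: letters_inj; rewrite !letters_wrap /= -!catA.
  + by move=> q'; apply: ctx_flat.
  + by [].
  by apply: funext => q'; apply: letters_inj; rewrite !letters_wrap /= -!catA.
Qed.

Lemma updK (T : Type) n (us : 'I_n -> T) k (w w' : T) : upd (upd us k w) k w' = upd us k w'.
Proof. by apply: funext => i; rewrite /upd; case: (i == k). Qed.

Lemma updC (T : Type) n (us : 'I_n -> T) k l (w w' : T) : k != l ->
  upd (upd us k w) l w' = upd (upd us l w') k w.
Proof.
move=> kl; apply: funext => i; rewrite /upd; case: eqP => [->|//].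
by rewrite eq_sym (negPf kl).
Qed.

(** Two holes inside letters: in different letters or in different operands of
    the same letter they are disjoint; in the same operand the question is the
    same one for the operand, and the answer is transported by the context. *)
Lemma overlap_nest a1 i1 t1 us1 k1 b1 phi p a2 i2 t2 us2 k2 b2 psi q :
  isctx phi -> isctx psi -> (phi p = psi q -> overlap phi p psi q) ->
  wrap a1 (@op_word i1 t1 us1 k1 (phi p)) b1 = wrap a2 (@op_word i2 t2 us2 k2 (psi q)) b2 ->
  overlap (fun r => wrap a1 (@op_word i1 t1 us1 k1 (phi r)) b1) p
          (fun r => wrap a2 (@op_word i2 t2 us2 k2 (psi r)) b2) q.
Proof.
move=> phiP psiP IH /wrap_eq_letter [[a [b [/(congr1 letters)]]]|[e [-> ->]]|[e [-> ->]]].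
- rewrite letters_wrap; case: a => [|y [|z a]] //= el -> ->.
  have eb : b = [::] by have := congr1 behead el.
  have {el} ex : Der i1 (Op t1 (upd us1 k1 (phi p))) = Der i2 (Op t2 (upd us2 k2 (psi q))).
    by have := congr1 (head (Der i1 (Op t1 us1))) el.
  subst b; rewrite cats0 /=.
  have ei : i1 = i2 by case: ex.
  have et : t1 = t2 by case: ex.
  subst i2 t2; have {ex} e : upd us1 k1 (phi p) = upd us2 k2 (psi q).
    by apply: Op_inj; have := congr1 (fun x : letter => let: Der _ c := x in c) ex.
  have [ek|nk] := eqVneq k1 k2.
    subst k2; have := congr1 (@^~ k1) e; rewrite /upd eqxx => /IH.
    (* The two families of operands agree outside [k1]. *)
    have -> : (fun r => wrap a1 (@op_word i1 t1 us2 k1 (psi r)) b1) =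
              (fun r => wrap a1 (@op_word i1 t1 us1 k1 (psi r)) b1).
      apply: funext => r; rewrite /op_word; congr (wrap _ (Sing (Der _ (Op _ _))) _).
      by rewrite -(updK us1 k1 (phi p)) e updK.
    apply: (overlap_comp (chi := fun s => wrap a1 (@op_word i1 t1 us1 k1 s) b1)).
    exact: ctx_nest isctx_id.
  apply: (@Disjoint _ _ _ _
    (fun p' q' => wrap a1 (Sing (Der i1 (Op t1 (upd (upd us1 k1 (phi p')) k2 (psi q'))))) b1)).
  + by move=> p'; apply: ctx_nest.
  + move=> q'; apply: (isctx_ext _ (ctx_nest a1 i1 (upd us1 k2 (psi q')) k1 b1 phiP)) => p'.
    by rewrite /op_word updC // eq_sym.
  + apply: funext => p'; congr (wrap _ (Sing (Der _ (Op _ _))) _).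
    rewrite updC //; congr (upd _ _ _); apply: funext => j; rewrite /upd.
    case: eqP => [->|//]; have := congr1 (@^~ k2) e.
    by rewrite /upd eqxx eq_sym (negPf nk).
  + apply: funext => q'; congr (wrap _ (Sing (Der _ (Op _ _))) _).
    by rewrite e updK.
- apply: (@Disjoint _ _ _ _ (fun p' q' => wrap a1 (@op_word i1 t1 us1 k1 (phi p'))
    (e ++ letters (@op_word i2 t2 us2 k2 (psi q')) ++ b2))) => //.
  + move=> p'; apply: (isctx_ext _
      (ctx_nest (a1 ++ letters (@op_word i1 t1 us1 k1 (phi p')) ++ e) i2 us2 k2 b2 psiP)) => q'.
    by apply: letters_inj; rewrite !letters_wrap /= -!catA.
  + by move=> q'; apply: ctx_nest.
  by apply: funext => q'; apply: letters_inj; rewrite !letters_wrap /= -!catA.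
- apply: (@Disjoint _ _ _ _ (fun p' q' => wrap (a2 ++ letters (@op_word i2 t2 us2 k2 (psi q')) ++ e)
    (@op_word i1 t1 us1 k1 (phi p')) b1)).
  + move=> p'; apply: (isctx_ext _
      (ctx_nest a2 i2 us2 k2 (e ++ letters (@op_word i1 t1 us1 k1 (phi p')) ++ b1) psiP)) => q'.
    by apply: letters_inj; rewrite !letters_wrap /= -!catA.
  + by move=> q'; apply: ctx_nest.
  + by [].
  by apply: funext => q'; apply: letters_inj; rewrite !letters_wrap /= -!catA.
Qed.

Lemma ctx_overlap phi p psi q :
  isctx phi -> isctx psi -> phi p = psi q -> overlap phi p psi q.
Proof.
move=> phiP; elim: phiP psi => [a b|a i t us k chi b chiP IH] psi.
  by case=> [a' b'|a' i' t' us' k' chi' b' chiP']; [apply: overlap_flat|apply: overlap_flat_nest].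
case=> [a' b'|a' i' t' us' k' chi' b' chiP'].
  by move=> e; apply: overlap_sym; apply: overlap_flat_nest.
by apply: overlap_nest => //; apply: IH.
Qed.

End Contexts.

(** * Linear maps, products, derivation and operators *)

Section Algebra.
Variables (dO dX : Order.disp_t) (O : orderType dO) (ar : O -> nat).
Variables (X : orderType dX) (K : fieldType) (lam : K).
Local Notation word := (word ar X).
Local Notation base := (base ar X).
Local Notation letter := (letter ar X).
Local Notation A := (DXO ar X K).
Local Notation mono := (@mono _ _ O ar X K).
Local Notation "f ** g" := (amul f g) (at level 40, left associativity).
Local Notation der := (der lam).
Implicit Types (u v w p q : word) (f g : A) (L : A -> A).

Lemma mcoeff_mono u v : (mono u)@_v = (u == v)%:R.
Proof. by rewrite mcoeffU. Qed.

Definition is_linear L : Prop := forall c f g, L (c *: f + g) = c *: L f + L g.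

Section IsLin.
Variable (L : A -> A).
Hypothesis linL : is_linear L.

Lemma lin0 : L 0 = 0.
Proof. by have /eqP := linL 1 0 0; rewrite !scale1r addr0 eq_sym -subr_eq0 addrK => /eqP. Qed.

Lemma linD f g : L (f + g) = L f + L g.
Proof. by have := linL 1 f g; rewrite !scale1r. Qed.

Lemma linZ c f : L (c *: f) = c *: L f.
Proof. by have := linL c f 0; rewrite lin0 !addr0. Qed.

Lemma linB f g : L (f - g) = L f - L g.
Proof. by rewrite linD -scaleN1r linZ scaleN1r. Qed.

Lemma lin_sum (I : Type) (r : seq I) (F : I -> A) :
  L (\sum_(i <- r) F i) = \sum_(i <- r) L (F i).
Proof. by elim: r => [|i r IH]; rewrite ?big_nil ?lin0 // !big_cons linD IH. Qed.

End IsLin.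

Lemma malg_expand f : f = \sum_(u <- msupp f) f@_u *: mono u.
Proof.
rewrite [LHS]monalgE; apply: eq_bigr => u _.
by apply/malgP => v; rewrite mcoeffZ !mcoeffU mulr_natr.
Qed.

Lemma lin_ext_eq L f : is_linear L -> L f = lin_ext (L \o mono) f.
Proof.
move=> linL; rewrite {1}(malg_expand f) (lin_sum linL).
by apply: eq_bigr => u _; rewrite (linZ linL).
Qed.

(** Identities between multilinear expressions are proved by reduction to words,
    one argument at a time, with this lemma. *)
Lemma lin_eq L L' : is_linear L -> is_linear L' ->
  (forall u, L (mono u) = L' (mono u)) -> forall f, L f = L' f.
Proof.
move=> lL lL' e f; rewrite (lin_ext_eq f lL) (lin_ext_eq f lL').
by apply: eq_bigr => u _; rewrite /= e.
Qed.

(** The sum can be taken over a common finite set of words, whence linearity. *)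
Lemma lin_extEw (h : word -> A) (d : {fset word}) f :
  (msupp f `<=` d)%fset -> lin_ext h f = \sum_(u <- d) f@_u *: h u.
Proof.
move=> le; rewrite /lin_ext (big_fset_incl _ le) => //= x xd /mcoeff_outdom ->.
by rewrite scale0r.
Qed.

Lemma lin_ext_lin (h : word -> A) : is_linear (lin_ext h).
Proof.
move=> c f g.
pose d := (msupp f `|` msupp g `|` msupp (c *: f + g))%fset.
rewrite !(@lin_extEw h d).
- rewrite scaler_sumr -big_split /=; apply: eq_bigr => u _.
  by rewrite mcoeffD mcoeffZ scalerDl scalerA.
- by apply/fsubsetP => u; rewrite !inE => ->; rewrite ?orbT.
- by apply/fsubsetP => u; rewrite !inE => ->; rewrite ?orbT.
- by apply/fsubsetP => u; rewrite !inE => ->; rewrite ?orbT.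
Qed.

Lemma lin_ext_mono (h : word -> A) u : lin_ext h (mono u) = h u.
Proof.
rewrite (lin_extEw _ (d := [fset u]%fset)); last exact: msuppU_le.
by rewrite big_seq_fset1 mcoeff_mono eqxx scale1r.
Qed.

Lemma lin_id : is_linear id. Proof. by []. Qed.

Lemma lin_comp L L' : is_linear L -> is_linear L' -> is_linear (L \o L').
Proof. by move=> l l' c f g; rewrite /= l' l. Qed.

Lemma lin_add L L' : is_linear L -> is_linear L' -> is_linear (fun f => L f + L' f).
Proof. by move=> l l' c f g; rewrite l l' scalerDr addrACA. Qed.

Lemma lin_scale d L : is_linear L -> is_linear (fun f => d *: L f).
Proof. by move=> l c f g; rewrite l scalerDr !scalerA mulrC. Qed.

Lemma amul_lin_l g : is_linear (fun f => f ** g).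
Proof. exact: lin_ext_lin. Qed.

Lemma amul_lin_r f : is_linear (fun g => f ** g).
Proof.
move=> c g g'; rewrite /amul /lin_ext scaler_sumr -big_split /=; apply: eq_bigr => u _.
by rewrite -/(lin_ext _ _) lin_ext_lin scalerDr !scalerA mulrC.
Qed.

Lemma amul_mono u v : mono u ** mono v = mono (cat_word u v).
Proof. by rewrite /amul !lin_ext_mono. Qed.

Lemma amulA f g h : f ** (g ** h) = (f ** g) ** h.
Proof.
pose L f := f ** (g ** h); pose L' f := (f ** g) ** h.
apply: (@lin_eq L L') => [||u].
- exact: amul_lin_l.
- exact: (lin_comp (@amul_lin_l h) (@amul_lin_l g)).
rewrite {}/L {}/L'; apply: (@lin_eq (fun g => _ ** (g ** h)) (fun g => (_ ** g) ** h)) => [||v].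
- exact: (lin_comp (@amul_lin_r (mono u)) (@amul_lin_l h)).
- exact: (lin_comp (@amul_lin_l h) (@amul_lin_r (mono u))).
apply: (@lin_eq (fun h => _ ** (_ ** h)) (fun h => (_ ** _) ** h)) => [||w].
- exact: (lin_comp (@amul_lin_r (mono u)) (@amul_lin_r (mono v))).
- exact: amul_lin_r.
by rewrite !amul_mono cat_wordA.
Qed.

Lemma der_lin : is_linear der.
Proof. exact: lin_ext_lin. Qed.

Lemma der_mono u : der (mono u) = derW lam u.
Proof. exact: lin_ext_mono. Qed.

Lemma der_cons x v : der (mono (Cons x v)) =
  lam *: (der (mono (Sing x)) ** der (mono v)) + der (mono (Sing x)) ** mono v
  + mono (Sing x) ** der (mono v).
Proof. by rewrite !der_mono; case: x. Qed.

Local Opaque amul Defs.der Defs.mono lin_ext.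

Lemma amulDl f g h : (f + g) ** h = f ** h + g ** h.
Proof. exact: (linD (@amul_lin_l h)). Qed.

Lemma amulDr f g h : f ** (g + h) = f ** g + f ** h.
Proof. exact: (linD (@amul_lin_r f)). Qed.

Lemma amulZl c f g : (c *: f) ** g = c *: (f ** g).
Proof. exact: (linZ (@amul_lin_l g)). Qed.

Lemma amulZr c f g : f ** (c *: g) = c *: (f ** g).
Proof. exact: (linZ (@amul_lin_r f)). Qed.

Lemma iter_der_lin n : is_linear (iter n der).
Proof. by elim: n => [|n IH] //; apply: (lin_comp der_lin IH). Qed.

(** The twisted product rule is compatible with associativity: expanding
    [D(x(uv))] and [D((xu)v)] with the rule gives the same seven terms. Here
    [x'], [u'] and [v'] stand for the derivatives. *)
Lemma twisted_derivation_assoc (V : lmodType K) (m : V -> V -> V) :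
  (forall f g h : V, m (f + g) h = m f h + m g h) ->
  (forall f g h : V, m f (g + h) = m f g + m f h) ->
  (forall (c : K) (f g : V), m (c *: f) g = c *: m f g) ->
  (forall (c : K) (f g : V), m f (c *: g) = c *: m f g) ->
  (forall f g h : V, m f (m g h) = m (m f g) h) ->
  forall x x' u u' v v' : V,
  lam *: m x' (lam *: m u' v' + m u' v + m u v') + m x' (m u v)
    + m x (lam *: m u' v' + m u' v + m u v') =
  lam *: m (lam *: m x' u' + m x' u + m x u') v'
    + m (lam *: m x' u' + m x' u + m x u') v + m (m x u) v'.
Proof.
move=> Dl Dr Zl Zr mA x x' u u' v v'.
by rewrite !Dr !Dl !Zr !Zl !scalerDr !mA !addrA [LHS](ACl (1*3*5*2*4*6*7)).
Qed.

(** The derivation is defined by splitting off the first letter of a word; that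
    the product rule holds for any splitting follows by induction on the left
    factor. *)
Lemma der_mul f g :
  der (f ** g) = lam *: (der f ** der g) + der f ** g + f ** der g.
Proof.
pose R f g := lam *: (der f ** der g) + der f ** g + f ** der g.
have Rl g' : is_linear (R^~ g').
  apply: lin_add; last exact: amul_lin_l.
  apply: lin_add; last exact: (lin_comp (@amul_lin_l g') der_lin).
  by apply: lin_scale; apply: (lin_comp (@amul_lin_l (der g')) der_lin).
have Rr f' : is_linear (R f').
  apply: lin_add; last exact: (lin_comp (@amul_lin_r f') der_lin).
  apply: lin_add; last exact: amul_lin_r.
  by apply: lin_scale; apply: (lin_comp (@amul_lin_r (der f')) der_lin).
apply: (@lin_eq (fun f => der (f ** g)) (R^~ g)) => // [|u].
  exact: (lin_comp der_lin (@amul_lin_l g)).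
apply: (@lin_eq (fun g => der (mono u ** g)) (R (mono u))) => // [|v {f g}].
  exact: (lin_comp der_lin (@amul_lin_r (mono u))).
rewrite amul_mono /R; elim: u => [x|x u IH]; first by rewrite -der_cons.
have ex w : mono (Cons x w) = mono (Sing x) ** mono w by rewrite amul_mono.
rewrite [cat_word _ _]/= (der_cons x (cat_word u v)) (der_cons x u) IH !ex -!amul_mono.
exact: (twisted_derivation_assoc amulDl amulDr amulZl amulZr amulA).
Qed.

Local Notation opw t us := (Sing (Der 0 (Op t us))) (only parsing).

Lemma op_letter_inj t i j (us vs : 'I_(ar t) -> word) :
  Sing (Der i (Op t us)) = Sing (Der j (Op t vs)) -> us = vs.
Proof.
move=> e; apply: Op_inj.
by have := congr1 (fun w : word => if w is Sing (Der _ c) then c else Op t us) e.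
Qed.

(** The defining sum ranges over the union of the supports. If some [us i] is
    outside of it, both sides vanish, so the formula holds for all words. *)
Lemma op_coef t (fs : 'I_(ar t) -> A) (us : 'I_(ar t) -> word) :
  (op fs)@_(opw t us) = \prod_(i < ar t) (fs i)@_(us i).
Proof.
rewrite /op; set B := (\bigcup_(i in _) _)%fset.
have coefE (v : {ffun 'I_(ar t) -> B}) :
    (\prod_(i < ar t) (fs i)@_(val (v i)) *:
       mono (Sing (Der 0 (Op t (fun i => val (v i))))))@_(opw t us) =
    \prod_(i < ar t) (fs i)@_(val (v i)) * ((fun i => val (v i)) == us)%:R.
  rewrite mcoeffZ mcoeff_mono; congr (_ * _%:R); congr nat_of_bool.
  by apply/eqP/eqP => [/op_letter_inj|->].
rewrite raddf_sum /= (eq_bigr _ (fun z _ => coefE z)) {coefE}.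
have [usB|/existsNP [i usiB]] := pselect (forall i, us i \in B).
  pose v0 : {ffun 'I_(ar t) -> B} := [ffun i => [` usB i]%fset].
  have v0E : (fun i => val (v0 i)) = us by apply: funext => i; rewrite ffunE.
  rewrite (bigD1 v0) //= v0E eqxx mulr1 [X in _ + X]big1 ?addr0 => [|v nv].
by apply: eq_bigr => i _; rewrite ffunE.
  case: eqP => [e|]; last by rewrite mulr0.
  case/negP: nv; apply/eqP/ffunP => i; apply: val_inj; rewrite /= ffunE /=.
  by have := congr1 (@^~ i) e.
rewrite big1.
  rewrite (bigD1 i) //= mcoeff_outdom ?mul0r //; apply/negP => h; apply: usiB.
  by apply/bigfcupP; exists i => //; rewrite mem_index_enum.
move=> v _; case: eqP => [e|]; last by rewrite mulr0.
by case: usiB; rewrite -e; apply: valP.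
Qed.

Lemma op_coef_out t (fs : 'I_(ar t) -> A) w :
  (forall us, w <> opw t us) -> (op fs)@_w = 0.
Proof.
move=> nw; rewrite /op raddf_sum big1 //= => v _.
by rewrite mcoeffZ mcoeff_mono; case: eqP => [e|]; rewrite ?mulr0 //; case: (nw _ (esym e)).
Qed.

Local Opaque Defs.op.

Lemma op_mono t (us : 'I_(ar t) -> word) : op (fun i => mono (us i)) = mono (opw t us).
Proof.
apply/malgP => w; have [[vs ->]|/forallNP nw] := pselect (exists vs, w = opw t vs).
  rewrite op_coef mcoeff_mono; case: eqP => [/op_letter_inj e|ne].
    by subst vs; apply: big1 => i _; rewrite mcoeff_mono eqxx.
  have [i nei] : exists i, us i <> vs i.
    by apply/existsNP => h; apply: ne; rewrite (funext h).
  by rewrite (bigD1 i) //= mcoeff_mono; case: eqP => // _; rewrite mul0r.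
rewrite op_coef_out // mcoeff_mono; case: eqP => // e; by case: (nw us).
Qed.

Lemma op_lin t (fs : 'I_(ar t) -> A) k : is_linear (fun f => op (upd fs k f)).
Proof.
move=> c f g; apply/malgP => w; rewrite mcoeffD mcoeffZ.
have [[vs ->]|/forallNP nw] := pselect (exists vs, w = opw t vs); last first.
  by rewrite !op_coef_out // mulr0 addr0.
have prodE h : \prod_(i < ar t) (upd fs k h i)@_(vs i) =
    h@_(vs k) * \prod_(i < ar t | i != k) (fs i)@_(vs i).
  rewrite (bigD1 k) //= /upd eqxx; congr (_ * _).
  by apply: eq_bigr => i /negPf ->.
by rewrite !op_coef !prodE mcoeffD mcoeffZ mulrDl mulrA.
Qed.

(** The evaluation of a context at an element of the algebra. *)
Definition cmap (phi : word -> word) : A -> A := lin_ext (mono \o phi).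

Lemma cmap_lin phi : is_linear (cmap phi).
Proof. exact: lin_ext_lin. Qed.

Lemma cmap_mono phi u : cmap phi (mono u) = mono (phi u).
Proof. exact: lin_ext_mono. Qed.

Lemma cmap_comp phi psi f : cmap (phi \o psi) f = cmap phi (cmap psi f).
Proof.
apply: (@lin_eq _ (cmap phi \o cmap psi)) => [||u]; first exact: cmap_lin.
  by apply: lin_comp; apply: cmap_lin.
by rewrite /= !cmap_mono.
Qed.

Lemma cmap_id f : cmap id f = f.
Proof.
apply: (@lin_eq _ id) => // [|u]; first exact: cmap_lin.
by rewrite cmap_mono.
Qed.

Lemma cmap_cat_l u f : mono u ** f = cmap (cat_word u) f.
Proof.
apply: (@lin_eq (amul (mono u))) => [||v]; [exact: amul_lin_r|exact: cmap_lin|].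
by rewrite cmap_mono amul_mono.
Qed.

Lemma cmap_cat_r u f : f ** mono u = cmap (fun p => cat_word p u) f.
Proof.
apply: (@lin_eq (fun f => f ** mono u) (cmap _)) => [||v]; [exact: amul_lin_l|exact: cmap_lin|].
by rewrite cmap_mono amul_mono.
Qed.

Lemma iter_der_letter n i (b : base) :
  iter n der (mono (Sing (Der i b))) = mono (Sing (Der (n + i) b)).
Proof. by elim: n => [|n IH] //; rewrite iterS IH der_mono. Qed.

Lemma iter_der_op n i t us k f :
  iter n der (cmap (@op_word _ _ O ar X i t us k) f) = cmap (@op_word _ _ O ar X (n + i) t us k) f.
Proof.
apply: (@lin_eq (iter n der \o cmap _) (cmap _)) => [||v].
- by apply: lin_comp; [apply: iter_der_lin|apply: cmap_lin].
- exact: cmap_lin.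
by rewrite /= !cmap_mono iter_der_letter.
Qed.

Lemma op_cmap t us k f :
  op (upd (fun i => mono (us i)) k f) = cmap (@op_word _ _ O ar X 0 t us k) f.
Proof.
apply: (@lin_eq (fun f => op (upd _ k f)) (cmap _)) => [||v]; [exact: op_lin|exact: cmap_lin|].
rewrite cmap_mono /op_word -op_mono; congr (op _); apply: funext => i.
by rewrite /upd; case: (i == k).
Qed.

(** * Leading words *)

Definition below w f : Prop := forall v, f@_v != 0 -> lt_word v w.

Lemma below0 w : below w 0.
Proof. by move=> v; rewrite mcoeff0 eqxx. Qed.

Lemma belowD w f g : below w f -> below w g -> below w (f + g).
Proof.
move=> hf hg v; rewrite mcoeffD; have [f0|/hf //] := eqVneq f@_v 0.
by rewrite f0 add0r => /hg.
Qed.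

Lemma belowZ w c f : below w f -> below w (c *: f).
Proof. by move=> hf v; rewrite mcoeffZ mulf_eq0 negb_or => /andP [_ /hf]. Qed.

Lemma below_sum w (I : eqType) (r : seq I) (F : I -> A) :
  (forall i, i \in r -> below w (F i)) -> below w (\sum_(i <- r) F i).
Proof.
elim: r => [|i r IH] h; first by rewrite big_nil; apply: below0.
rewrite big_cons; apply: belowD; first by apply: h; rewrite mem_head.
by apply: IH => j jr; apply: h; rewrite inE jr orbT.
Qed.

Lemma below_mono v w : lt_word v w -> below w (mono v).
Proof. by move=> vw u; rewrite mcoeff_mono; have [<-|_] := eqVneq v u; rewrite ?eqxx. Qed.

Lemma below_coef w f : below w f -> f@_w = 0.
Proof. by move=> h; apply/eqP; apply: contraFT (lt_word_irr w) => /h. Qed.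

(** [w] is the leading word of [f] and [c] its leading coefficient. In this form
    the property is stable under linear maps that respect the order. *)
Definition haslead f w c : Prop := c != 0 /\ below w (f - c *: mono w).

Lemma haslead_coef f w c : haslead f w c -> f@_w = c.
Proof.
case=> _ /below_coef /eqP.
by rewrite mcoeffB mcoeffZ mcoeff_mono eqxx mulr1 subr_eq0 => /eqP.
Qed.

Lemma haslead_le f w c v : haslead f w c -> f@_v != 0 -> v = w \/ lt_word v w.
Proof.
move=> [c0 h] fv; have [->|ne] := eqVneq v w; [by left|right]; apply: h.
by rewrite mcoeffB mcoeffZ mcoeff_mono [w == v]eq_sym (negPf ne) mulr0 subr0.
Qed.

Lemma haslead_of_le f w : f@_w != 0 ->
  (forall v, f@_v != 0 -> v = w \/ lt_word v w) -> haslead f w f@_w.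
Proof.
move=> fw h; split=> // v; rewrite mcoeffB mcoeffZ mcoeff_mono.
have [->|ne] := eqVneq w v; first by rewrite mulr1 subrr eqxx.
by rewrite mulr0 subr0 => /h [e|//]; rewrite e eqxx in ne.
Qed.

Lemma max_word (r : seq word) : r != [::] ->
  exists2 w, w \in r & forall v, v \in r -> v = w \/ lt_word v w.
Proof.
elim: r => [//|x r IH] _; case: r IH => [|y r] IH.
  by exists x => [|v]; rewrite inE ?eqxx // => /eqP; left.
have [//|w wr h] := IH.
case: (lt_word_total x w) => [xw|xw|wx].
- exists w => [|v]; first by rewrite inE wr orbT.
  by rewrite inE => /orP [/eqP ->|/h]; [left|].
- exists w => [|v]; first by rewrite inE wr orbT.
  by rewrite inE => /orP [/eqP ->|/h]; [right|].
exists x => [|v]; first by rewrite inE eqxx.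
rewrite inE => /orP [/eqP ->|/h]; first by left.
by case=> [->|/lt_word_trans vw]; right => //; apply: vw.
Qed.

Lemma haslead_ex f : f <> 0 -> exists w c, haslead f w c.
Proof.
move=> f0; have [|w wf h] := @max_word (enum_fset (msupp f)).
  by apply/eqP => e; apply: f0; rewrite (malg_expand f) e big_nil.
exists w, f@_w; apply: haslead_of_le => [|v]; first by rewrite mcoeff_neq0.
by rewrite mcoeff_neq0; apply: h.
Qed.

Lemma haslead_leadw f w c : haslead f w c -> leadw f = Some w.
Proof.
move=> hw; have wf : w \in msupp f by rewrite -mcoeff_neq0 (haslead_coef hw) hw.1.
rewrite /leadw; case: pickP => [w' /forallP h|/(_ [` wf]%fset)] /=.
  congr Some; have := h [` wf]%fset; rewrite -val_eqE /= => /orP [/eqP //|lt1].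
  have := haslead_le hw (v := val w'); rewrite mcoeff_neq0 => /(_ (valP w')) [//|lt2].
  by have := lt_word_trans lt1 lt2; rewrite lt_word_irr.
move/negbT/forallPn => [v]; rewrite -val_eqE negb_or => /andP [/= ne nlt].
have := haslead_le hw (v := val v); rewrite mcoeff_neq0 => /(_ (valP v)) [e|lt1].
  by rewrite e eqxx in ne.
by rewrite lt1 in nlt.
Qed.

Lemma haslead_lm f w c : haslead f w c -> lm f = mono w.
Proof. by rewrite /lm => /haslead_leadw ->. Qed.

Lemma haslead_lc f w c : haslead f w c -> lc f = c.
Proof. by move=> h; rewrite /lc (haslead_leadw h) (haslead_coef h). Qed.

Lemma haslead_bre f w c : haslead f w c -> bre_lead f = bre w.
Proof. by rewrite /bre_lead => /haslead_leadw ->. Qed.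

Lemma mono_word_inj : injective mono.
Proof.
move=> u v e; have := mcoeff_mono u v; rewrite e mcoeff_mono eqxx.
by case: eqP => // _ /eqP; rewrite oner_eq0.
Qed.

Lemma haslead_mono u : haslead (mono u) u 1.
Proof. by split; rewrite ?oner_eq0 // scale1r subrr; apply: below0. Qed.

Lemma haslead_uniq f w c w' c' : haslead f w c -> haslead f w' c' -> w = w' /\ c = c'.
Proof.
move=> h h'; have e : w = w' by apply: mono_word_inj; rewrite -(haslead_lm h) (haslead_lm h').
by subst w'; rewrite -(haslead_coef h) (haslead_coef h').
Qed.

Lemma haslead_le_below f w v c : haslead f v c -> lt_word v w -> below w f.
Proof. by move=> h vw u /(haslead_le h) [->|/lt_word_trans]; [|apply]. Qed.

Lemma haslead_scale f w c d : d != 0 -> haslead f w c -> haslead (d *: f) w (d * c).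
Proof.
move=> d0 [c0 h]; split; first by rewrite mulf_neq0.
by rewrite -scalerA -scalerBr; apply: belowZ.
Qed.

Lemma haslead_add f g w c : haslead f w c -> below w g -> haslead (f + g) w c.
Proof. by move=> [c0 h] hg; split=> //; rewrite addrAC; apply: belowD. Qed.

(** Contexts and powers of the derivation are both of this kind, and so are their
    composites: substitution in any star word. For contexts the image of a
    word is a word; for the derivation it is not. *)
Record lead_map L (phi : word -> word) : Prop := LeadMap {
  lead_map_lin : is_linear L;
  lead_map_lt : forall u v, lt_word u v -> lt_word (phi u) (phi v);
  lead_map_mono : forall u, exists d, haslead (L (mono u)) (phi u) d }.

Lemma below_lead_map L phi w f : lead_map L phi -> below w f -> below (phi w) (L f).
Proof.
move=> LP h; rewrite (lin_ext_eq f (lead_map_lin LP)); apply: below_sum => v vf.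
have vw := h v; rewrite mcoeff_neq0 in vw.
have [d hd] := lead_map_mono LP v; apply: belowZ.
by apply: haslead_le_below hd _; apply: lead_map_lt LP _ _ (vw vf).
Qed.

(** The part of [f] below [w] is sent below [phi w], because [phi] is increasing,
    and so cannot interfere with the image of the leading word. *)
Lemma haslead_map L phi f w c d : lead_map L phi -> haslead f w c ->
  haslead (L (mono w)) (phi w) d -> haslead (L f) (phi w) (c * d).
Proof.
move=> LP [c0 h] hd; have lL := lead_map_lin LP.
rewrite -[f](subrK (c *: mono w)) addrC (linD lL) (linZ lL).
by apply: haslead_add; [apply: haslead_scale|apply: below_lead_map].
Qed.

Lemma haslead_map_ex L phi f w c : lead_map L phi -> haslead f w c ->
  exists d, haslead (L f) (phi w) d.
Proof.
move=> LP h; have [d hd] := lead_map_mono LP w.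
by exists (c * d); apply: haslead_map hd.
Qed.

Lemma lead_map_id : lead_map id id.
Proof. by split=> // u; exists 1; apply: haslead_mono. Qed.

Lemma lead_map_comp L phi L' phi' :
  lead_map L phi -> lead_map L' phi' -> lead_map (L \o L') (phi \o phi').
Proof.
move=> LP LP'; split.
- exact: lin_comp (lead_map_lin LP) (lead_map_lin LP').
- by move=> u v uv; apply: (lead_map_lt LP); apply: lead_map_lt LP' _ _ uv.
by move=> u; have [d hd] := lead_map_mono LP' u; apply: haslead_map_ex LP hd.
Qed.

Lemma lead_map_cmap phi : isctx phi -> lead_map (cmap phi) phi.
Proof.
move=> phiP; split=> [|u v|u]; [exact: cmap_lin|exact: lt_ctx|].
by exists 1; rewrite cmap_mono; apply: haslead_mono.
Qed.

Lemma haslead_cmap phi f w c : isctx phi -> haslead f w c -> haslead (cmap phi f) (phi w) c.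
Proof.
move=> phiP h; rewrite -[c]mulr1; apply: haslead_map h _; first exact: lead_map_cmap.
by rewrite cmap_mono; apply: haslead_mono.
Qed.

(** The leading word of the derivative of a word. Breadth and degree do not change
    under derivation, so the letters decide, from left to right. For [lam = 0] a
    term differentiates exactly one letter, and the first one is the best
    choice; otherwise all the letters can be differentiated, at the price of a
    factor [lam] for each letter but one. *)
Fixpoint der_lead u : word :=
  match u with
  | Sing (Der i b) => Sing (Der i.+1 b)
  | Cons (Der i b) v => Cons (Der i.+1 b) (if lam == 0 then v else der_lead v)
  end.

Fixpoint der_lc u : K :=
  match u with Sing _ => 1 | Cons _ v => if lam == 0 then 1 else lam * der_lc v end.

Lemma degW_der_lead u : degW (der_lead u) = degW u.
Proof. by elim: u => [[i b]|[i b] u IH] //=; case: ifP => // _; rewrite IH. Qed.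

Lemma bre_der_lead u : bre (der_lead u) = bre u.
Proof. by elim: u => [[i b]|[i b] u IH] //=; case: ifP => // _; rewrite IH. Qed.

Lemma lt_letter_der i j (b c : base) :
  lt_letter (Der i b) (Der j c) -> lt_letter (Der i.+1 b) (Der j.+1 c).
Proof. by move/lt_letterE => h; apply/lt_letterE; rewrite ltnS; intuition. Qed.

Lemma lex_word_consE x y u v :
  lex_word (Cons x u) (Cons y v) = lex_step (@lt_letter _ _ O ar X) x y (lex_word u v).
Proof. by []. Qed.

Lemma lt_der_lead u v : lt_word u v -> lt_word (der_lead u) (der_lead v).
Proof.
move/lt_wordE => h; apply/lt_wordE; rewrite !degW_der_lead !bre_der_lead.
case: h => [|[-> h]]; first by left.
right; split=> //; case: h => [|[-> h]]; [by left|right; split=> //].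
elim: u v h => [[i b]|[i b] u IH] [[j c]|[j c] v] //.
rewrite [der_lead (Cons _ _)]/= [der_lead (Cons (Der j c) v)]/= !lex_word_consE.
move=> /lex_stepP [h|[[-> ->] h]]; apply/lex_stepP.
  by left; apply: lt_letter_der h.
by right; split=> //; have {}IH := IH v h; case: (lam == 0).
Qed.

(** When the first letter is strictly larger, the tails only matter through their
    degree and breadth. *)
Lemma lt_cons x y u v : lt_letter x y ->
  (degW u < degW v \/ degW u = degW v /\ bre u <= bre v)%N ->
  lt_word (Cons x u) (Cons y v).
Proof.
move=> xy h; have le : (degL x <= degL y)%N.
  by case: x y xy => [i b] [j c] /lt_letterE [/ltnW|[e _]] //=; rewrite e.
apply/lt_wordE => /=; case: h => [lt1|[-> h]]; first by left; rewrite -addnS; apply: leq_add.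
move: le; rewrite leq_eqVlt => /orP [/eqP ->|le]; last by left; rewrite ltn_add2r.
right; split=> //; move: h; rewrite leq_eqVlt => /orP [/eqP ->|lt1]; last by left.
by right; split=> //; apply/lex_stepP; left.
Qed.

Lemma lt_letter_der1 i (b : base) : lt_letter (Der i b) (Der i.+1 b).
Proof. by apply/lt_letterE; right; split=> //; left. Qed.

Lemma lt_der_lead1 u : lt_word u (der_lead u).
Proof.
case: u => [[i b]|[i b] u].
  by apply/lt_wordE; right; split=> //; right; split=> //; apply: lt_letter_der1.
apply: lt_cons; first exact: lt_letter_der1.
by right; case: ifP => // _; rewrite degW_der_lead bre_der_lead.
Qed.

(** By induction on the word, from the three terms of the product rule. The term
    where the first letter is not differentiated is always smaller, since its
    tail has the same degree and breadth and its first letter is smaller. Of the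
    other two, the one with the factor [lam] is the larger if it is present. *)
Lemma haslead_der u : haslead (der (mono u)) (der_lead u) (der_lc u).
Proof.
elim: u => [[i b]|[i b] u IH].
  by rewrite der_mono; apply: haslead_mono.
rewrite der_cons der_mono -/derW.
have below3 : below (der_lead (Cons (Der i b) u)) (mono (Sing (Der i b)) ** der (mono u)).
  rewrite cmap_cat_l (lin_ext_eq (der _) (@cmap_lin _)); apply: below_sum => v.
  rewrite -mcoeff_neq0 => vu; apply: belowZ; rewrite /= cmap_mono; apply: below_mono.
  apply: lt_cons; first exact: lt_letter_der1.
  have sh w : degW w = degW u -> bre w = bre u ->
      (degW v < degW w \/ degW v = degW w /\ bre v <= bre w)%N.
    move=> -> ->; rewrite -(degW_der_lead u) -(bre_der_lead u).
    case: (haslead_le IH vu) => [->|/lt_wordE [|[? [/ltnW|[->]]]]]; by [left|right].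
  by case: ifP => _; apply: sh; rewrite ?degW_der_lead ?bre_der_lead.
apply: haslead_add below3; rewrite /= !cmap_cat_l.
have [l0|l0] := eqVneq lam 0.
  by rewrite [X in X *: _]l0 scale0r add0r cmap_mono; apply: haslead_mono.
apply: haslead_add.
  exact: haslead_scale l0 (haslead_cmap (isctx_cat_l (Sing (Der i.+1 b))) IH).
rewrite cmap_mono; apply: below_mono; apply: (lt_cat_l (Sing _)); exact: lt_der_lead1.
Qed.

Lemma lead_map_der : lead_map der der_lead.
Proof.
split=> [|u v|u]; [exact: der_lin|exact: lt_der_lead|].
by exists (der_lc u); apply: haslead_der.
Qed.

Lemma lead_map_iter_der n : lead_map (iter n der) (iter n der_lead).
Proof.
elim: n => [|n IH]; first exact: lead_map_id.
exact: lead_map_comp lead_map_der IH.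
Qed.

Lemma bre_iter_der_lead n u : bre (iter n der_lead u) = bre u.
Proof. by elim: n => [|n IH] //=; rewrite bre_der_lead. Qed.

End Algebra.

(** * Star words and contexts *)

Section StarContexts.
Variables (dO dX : Order.disp_t) (O : orderType dO) (ar : O -> nat).
Variables (X : orderType dX) (K : fieldType) (lam : K).
Local Notation word := (word ar X).
Local Notation base := (base ar X).
Local Notation letter := (letter ar X).
Local Notation A := (DXO ar X K).
Local Notation mono := (@mono _ _ O ar X K).
Local Notation "f ** g" := (amul f g) (at level 40, left associativity).
Local Notation der := (der lam).
Local Notation op_word := (@op_word _ _ O ar X).
Local Opaque amul Defs.der Defs.mono Defs.op lin_ext cmap.
Implicit Types (u v w p q : word) (f g s : A) (phi chi : word -> word).

Lemma subst_no_star :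
  (forall b : Defs.base ar (option X), starsB b = 0%N ->
     exists c : base, forall i s, iter i der (substB lam b s) = mono (Sing (Der i c))) /\
  (forall x : Defs.letter ar (option X), starsL x = 0%N ->
     exists y : letter, forall s, substL lam x s = mono (Sing y)) /\
  (forall u : Defs.word ar (option X), starsW u = 0%N ->
     exists v, forall s, substW lam u s = mono v).
Proof.
apply: base_letter_word_ind => [[x|//]|t us IH|i b IH|x IH|x IHx u IHu] /=.
- by move=> _; exists (Var x) => i s; rewrite iter_der_letter addn0.
- move=> /eqP; rewrite sum_nat_eq0 => /forallP us0.
  have /choice [vs vsE] i := IH i (eqP (us0 i)).
  exists (Op t vs) => i s.
  rewrite (_ : (fun j => _) = (fun j => mono (vs j))); last by apply: funext => j.
  by rewrite op_mono iter_der_letter addn0.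
- by move=> /IH [c cE]; exists (Der i c) => s; rewrite cE.
- by move=> /IH [y yE]; exists (Sing y) => s; rewrite yE.
move/eqP; rewrite addn_eq0 => /andP [/eqP /IHx [y yE] /eqP /IHu [v vE]].
by exists (Cons y v) => s; rewrite yE vE amul_mono.
Qed.

(** A star directly under [D^i] turns into the identity context applied to the
    [i]-th derivative of the substituted element; any other derivation symbol
    stands over an operator and becomes part of the context. For the base
    element the context depends on the power of [D] applied from outside,
    except when it is the star itself. The word [w0] is a dummy value for the
    operand that contains the star. *)
Lemma subst_one_star (w0 : word) :
  (forall b : Defs.base ar (option X), starsB b = 1%N ->
     (forall s, substB lam b s = s) \/
     exists (phi : nat -> word -> word) (j : nat), (forall i, isctx (phi i)) /\
       forall i s, iter i der (substB lam b s) = cmap (phi i) (iter j der s)) /\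
  (forall x : Defs.letter ar (option X), starsL x = 1%N ->
     exists phi j, isctx phi /\ forall s, substL lam x s = cmap phi (iter j der s)) /\
  (forall u : Defs.word ar (option X), starsW u = 1%N ->
     exists phi j, isctx phi /\ forall s, substW lam u s = cmap phi (iter j der s)).
Proof.
apply: base_letter_word_ind => [[x|]|t us IH|i b IH|x IH|x IHx u IHu] //=.
- by left.
- move=> /eqP /sum_nat_eq1 [k [_ us1 us0]]; right.
  have [phi [j [phiP phiE]]] := IH k us1.
  have /choice [vs vsE] : forall i, exists v, i != k -> forall s, substW lam (us i) s = mono v.
    move=> i; have [->|ik] := eqVneq i k; first by exists w0.
    by have [v vE] := subst_no_star.2.2 _ (us0 i ik isT); exists v.
  exists (fun i p => op_word i vs k (phi p)), j; split=> [i|i s]; first exact: isctx_op.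
  rewrite (_ : (fun i0 => _) = upd (fun i0 => mono (vs i0)) k (cmap phi (iter j der s))).
    by rewrite op_cmap iter_der_op addn0 -cmap_comp.
  by apply: funext => l; rewrite /upd; case: eqP => [->|/eqP /vsE].
- move=> /IH [bE|[phi [j [phiP phiE]]]].
    exists id, i; split=> [|s]; first exact: isctx_id.
    by rewrite bE cmap_id.
  by exists (phi i), j; split=> [|s]; [apply: phiP|rewrite phiE].
move=> e; have [x0|x1] : starsL x = 0%N /\ starsW u = 1%N \/ starsL x = 1%N /\ starsW u = 0%N.
  by case: (starsL x) e => [|[|n]] /=; [left|case: (starsW u); right|].
- have [y yE] := subst_no_star.2.1 _ x0.1; have [phi [j [phiP phiE]]] := IHu x0.2.
  exists (cat_word (Sing y) \o phi), j; split=> [|s].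
    exact: isctx_comp (isctx_cat_l _) phiP.
  by rewrite yE phiE cmap_cat_l -cmap_comp.
have [v vE] := subst_no_star.2.2 _ x1.2; have [phi [j [phiP phiE]]] := IHx x1.1.
exists ((fun p => cat_word p v) \o phi), j; split=> [|s].
  exact: isctx_comp (isctx_cat_r _) phiP.
by rewrite vE phiE cmap_cat_r -cmap_comp.
Qed.

Lemma star_ctx (w0 : word) (u : star_word ar X) :
  exists phi j, isctx phi /\ forall s, subst lam u s = cmap phi (iter j der s).
Proof. by case: u => u u1; apply: (subst_one_star w0).2.2; apply/eqP. Qed.

Fixpoint starlessB (b : base) : Defs.base ar (option X) :=
  match b with
  | Var x => Var (Some x)
  | Op t us => Op t (fun i => starlessW (us i))
  end
with starlessL (x : letter) : Defs.letter ar (option X) :=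
  match x with Der i b => Der i (starlessB b) end
with starlessW u : Defs.word ar (option X) :=
  match u with
  | Sing x => Sing (starlessL x)
  | Cons x v => Cons (starlessL x) (starlessW v)
  end.

Lemma subst_starless :
  (forall b : base, starsB (starlessB b) = 0%N /\
     forall i s, iter i der (substB lam (starlessB b) s) = mono (Sing (Der i b))) /\
  (forall x : letter, starsL (starlessL x) = 0%N /\
     forall s, substL lam (starlessL x) s = mono (Sing x)) /\
  (forall u, starsW (starlessW u) = 0%N /\
     forall s, substW lam (starlessW u) s = mono u).
Proof.
apply: base_letter_word_ind => [x|t us IH|i b [IH1 IH2]|x [IH1 IH2]|x [x1 x2] u [u1 u2]] /=.
- by split=> // i s; rewrite iter_der_letter addn0.
- split=> [|i s]; first by apply: big1 => i _; apply: (IH i).1.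
  rewrite (_ : (fun j => _) = (fun j => mono (us j))); last first.
    by apply: funext => j; apply: (IH j).2.
  by rewrite op_mono iter_der_letter addn0.
- by split.
- by split.
by rewrite x1 u1; split=> // s; rewrite x2 u2 amul_mono.
Qed.

Lemma stars_cat (u v : Defs.word ar (option X)) :
  starsW (cat_word u v) = (starsW u + starsW v)%N.
Proof. by elim: u => [x|x u IH] //=; rewrite IH addnA. Qed.

Lemma subst_cat (u v : Defs.word ar (option X)) s :
  substW lam (cat_word u v) s = substW lam u s ** substW lam v s.
Proof.
elim: u => [x|x u IH]; first exact: erefl.
rewrite -[LHS]/(substL lam x s ** substW lam (cat_word u v) s).
by rewrite -[substW lam (Cons x u) s]/(substL lam x s ** substW lam u s) IH amulA.
Qed.

Definition from_star phi : Prop := exists u : Defs.word ar (option X),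
  starsW u = 1%N /\ forall s, substW lam u s = cmap phi s.

Lemma from_star_cat_l w phi : from_star phi -> from_star (fun p => cat_word w (phi p)).
Proof.
move=> [u [u1 uE]]; exists (cat_word (starlessW w) u).
rewrite stars_cat u1 (subst_starless.2.2 w).1; split=> // s.
by rewrite subst_cat uE (subst_starless.2.2 w).2 cmap_cat_l -cmap_comp.
Qed.

Lemma from_star_cat_r w phi : from_star phi -> from_star (fun p => cat_word (phi p) w).
Proof.
move=> [u [u1 uE]]; exists (cat_word u (starlessW w)).
rewrite stars_cat u1 (subst_starless.2.2 w).1; split=> // s.
by rewrite subst_cat uE (subst_starless.2.2 w).2 cmap_cat_r -cmap_comp.
Qed.

Lemma from_star_wrap a b phi : from_star phi -> from_star (fun p => wrap a (phi p) b).
Proof.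
move=> phiP; rewrite /wrap; elim: a => [|x a IH] /=; last exact: (from_star_cat_l (Sing x)).
elim: b phi phiP => [|y b IH] phi phiP //=.
by apply: (IH (fun p => cat_word (phi p) (Sing y))); apply: from_star_cat_r.
Qed.

Lemma from_star_op i t us k phi :
  from_star phi -> from_star (fun p => @op_word i t us k (phi p)).
Proof.
move=> [u [u1 uE]].
exists (Sing (Der i (Op t (upd (fun j => starlessW (us j)) k u)))); split=> [|s] /=.
  rewrite (bigD1 k) //= big1 => [|j /negPf jk]; rewrite /upd ?eqxx ?u1 // jk.
  exact: (subst_starless.2.2 _).1.
rewrite (_ : (fun j => _) = upd (fun j => mono (us j)) k (cmap phi s)).
  by rewrite op_cmap iter_der_op addn0 -cmap_comp.
apply: funext => l; rewrite /upd; case: (l == k); first exact: uE.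
exact: (subst_starless.2.2 _).2.
Qed.

(** Conversely, each context comes from a star word: the star is put in its hole,
    without derivation. *)
Lemma ctx_star phi : isctx phi -> exists u : star_word ar X,
  forall s, subst lam u s = cmap phi s.
Proof.
move=> phiP; suff [u [/eqP u1 uE]] : from_star phi by exists (exist _ u u1).
elim: phiP => [a b|a i t us k chi b _ IH].
  apply: (@from_star_wrap a b id); exists (Sing (Der 0 (Var None))); split=> // s.
  by rewrite cmap_id.
by apply: from_star_wrap; apply: from_star_op.
Qed.

End StarContexts.

(** * Normal S-words *)

Section CompositionDiamond.
Variables (dO dX : Order.disp_t) (O : orderType dO) (ar : O -> nat).
Variables (X : orderType dX) (K : fieldType) (lam : K).
Local Notation word := (word ar X).
Local Notation A := (DXO ar X K).
Local Notation mono := (@mono _ _ O ar X K).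
Local Notation "f ** g" := (amul f g) (at level 40, left associativity).
Local Notation der := (der lam).
Local Notation op_word := (@op_word _ _ O ar X).
Local Notation der_lead := (@der_lead _ _ O ar X K lam).
Local Opaque amul Defs.der Defs.mono Defs.op lin_ext cmap.
Implicit Types (u v w p q : word) (f g h s : A) (phi chi : word -> word).

Inductive span (G : A -> Prop) : A -> Prop :=
| span0 : span G 0
| span_cons c g f of G g & span G f : span G (c *: g + f).

Lemma span_gen (G : A -> Prop) g : G g -> span G g.
Proof. by move=> Gg; rewrite -[g]addr0 -[g]scale1r; apply: span_cons (span0 G). Qed.

Lemma spanD (G : A -> Prop) f g : span G f -> span G g -> span G (f + g).
Proof.
elim=> [|c x f' Gx _ IH] Gg; first by rewrite add0r.
by rewrite -addrA; apply: span_cons (IH Gg).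
Qed.

Lemma spanZ (G : A -> Prop) c f : span G f -> span G (c *: f).
Proof.
elim=> [|d x f' Gx _ IH]; first by rewrite scaler0; apply: span0.
by rewrite scalerDr scalerA; apply: span_cons IH.
Qed.

Lemma spanN (G : A -> Prop) f : span G f -> span G (- f).
Proof. by rewrite -scaleN1r; apply: spanZ. Qed.

Lemma span_sum (G : A -> Prop) (I : eqType) (r : seq I) (F : I -> A) :
  (forall i, i \in r -> span G (F i)) -> span G (\sum_(i <- r) F i).
Proof.
elim: r => [|i r IH] h; first by rewrite big_nil; apply: span0.
rewrite big_cons; apply: spanD; first by apply: h; rewrite mem_head.
by apply: IH => j jr; apply: h; rewrite inE jr orbT.
Qed.

Lemma span_lin (G G' : A -> Prop) L f :
  is_linear L -> (forall g, G g -> span G' (L g)) -> span G f -> span G' (L f).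
Proof.
move=> lL h; elim=> [|c x f' Gx _ IH]; first by rewrite (lin0 lL); apply: span0.
by rewrite lL; apply: spanD => //; apply: spanZ; apply: h.
Qed.

Lemma span_sub (G G' : A -> Prop) f : (forall g, G g -> G' g) -> span G f -> span G' f.
Proof. by move=> h; apply: (span_lin (@lin_id _ _ _ _ _ _)) => g /h; apply: span_gen. Qed.

Lemma lin_mono_ind (L : A -> A) (P : A -> Prop) f :
  is_linear L -> P 0 -> (forall g h, P g -> P h -> P (g + h)) ->
  (forall c g, P g -> P (c *: g)) ->
  (forall u, u \in msupp f -> P (L (mono u))) -> P (L f).
Proof.
move=> lL P0 PD PZ h; rewrite [f in L f]malg_expand (lin_sum lL).
have sub : {subset enum_fset (msupp f) <= msupp f} by [].
elim: (enum_fset (msupp f)) sub => [|u r IH] sub; first by rewrite big_nil.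
rewrite big_cons (linZ lL); apply: PD; first by apply: PZ; apply: h; apply: sub; rewrite mem_head.
by apply: IH => v vr; apply: sub; rewrite inE vr orbT.
Qed.

Variable S : A -> Prop.

(** Normal S-words with leading word [w], divided by their leading coefficient so
    that two of them with the same leading word can be compared by subtraction.
    Only contexts without derivation over the hole are used, and derivations of
    [s] replace the others. *)
Definition term w g : Prop := exists phi s l v c,
  [/\ isctx phi, S s, haslead (iter l der s) v c, w = phi v & g = c^-1 *: cmap phi (iter l der s)].

Lemma term_lead w g : term w g -> haslead g w 1.
Proof.
move=> [phi [s [l [v [c [phiP _ h -> ->]]]]]].
rewrite -(mulVf h.1); apply: haslead_scale; first by rewrite invr_eq0 h.1.
exact: haslead_cmap.
Qed.

Lemma term_ctx chi w g : isctx chi -> term w g -> term (chi w) (cmap chi g).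
Proof.
move=> chiP [phi [s [l [v [c [phiP Ss h -> ->]]]]]].
exists (chi \o phi), s, l, v, c; split=> //; first exact: isctx_comp.
by rewrite (linZ (@cmap_lin _ _ _ _ _ _ _)) cmap_comp.
Qed.

(** Being congruent to 0 modulo [(S,w)]. *)
Definition below_terms w := span (fun g => exists2 u, lt_word u w & term u g).
Definition all_terms := span (fun g => exists u, term u g).

Lemma below_all w f : below_terms w f -> all_terms f.
Proof. by apply: span_sub => g [u _ ?]; exists u. Qed.

Lemma below_terms_ctx chi w f :
  isctx chi -> below_terms w f -> below_terms (chi w) (cmap chi f).
Proof.
move=> chiP; apply: span_lin; first exact: cmap_lin.
move=> g [u uw gt]; apply: span_gen; exists (chi u); first exact: lt_ctx.
exact: term_ctx.
Qed.

Lemma below_terms_lt v w f : lt_word v w -> below_terms v f -> below_terms w f.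
Proof.
by move=> vw; apply: span_sub => g [u uv gt]; exists u => //; apply: lt_word_trans vw.
Qed.

Lemma below_terms_below w f : below_terms w f -> below w f.
Proof.
elim=> [|c g f' [u uw gt] _ IH]; first exact: below0.
by apply: belowD => //; apply: belowZ; apply: haslead_le_below (term_lead gt) uw.
Qed.

Hypothesis S_monic : forall s, S s -> is_monic s.

Lemma monic_lead s : S s -> exists w, haslead s w 1.
Proof.
move=> /S_monic s1; have [|w [c h]] := @haslead_ex _ _ _ _ _ _ s.
  move=> s0; move: s1; rewrite /is_monic /lc s0; case: leadw => [w|] /eqP.
    by rewrite mcoeff0 eq_sym oner_eq0.
  by rewrite eq_sym oner_eq0.
by exists w; move: s1 (h); rewrite /is_monic (haslead_lc h) => ->.
Qed.

Lemma iter_der_haslead s w c l :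
  haslead s w c -> exists d, haslead (iter l der s) (iter l der_lead w) d.
Proof. exact: haslead_map_ex (lead_map_iter_der _ _ _ l). Qed.

Lemma monic_iter_lead s l : S s -> exists w c,
  [/\ haslead (iter l der s) w c & bre w = bre_lead s].
Proof.
move=> /monic_lead [w h]; have [d hd] := iter_der_haslead l h.
by exists (iter l der_lead w), d; rewrite bre_iter_der_lead (haslead_bre h).
Qed.

(** If the star is under [D^j], the leading word of the value is
    [phi (iter j der_lead v)], where [v] is the leading word of [D^i(s)]. When
    the value at [v] is a single word, it must be this one, with coefficient 1.
    So the value at [D^i(s)] is normal and keeps the leading coefficient of
    [D^i(s)]. *)
Lemma star_term (u : star_word ar X) s i w :
  S s -> subst lam u (lm (iter i der s)) = mono w ->
  exists c g, [/\ lc (iter i der s) = c, haslead (subst lam u (iter i der s)) w c, term w g,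
     subst lam u (iter i der s) = c *: g & normal lam u (iter i der s)].
Proof.
move=> Ss; have [v [c [h _]]] := monic_iter_lead i Ss.
have [phi [j [phiP uE]]] := star_ctx lam v u.
rewrite (haslead_lm h) => uw.
pose L := cmap phi \o iter j der.
have LP : lead_map L (phi \o iter j der_lead).
  exact: lead_map_comp (lead_map_cmap _ phiP) (lead_map_iter_der _ _ _ j).
have uL f : subst lam u f = L f by apply: uE.
have [d hd] := lead_map_mono LP v.
have hw : haslead (L (mono v)) w 1 by rewrite -uL uw; apply: haslead_mono.
have [ew ed] := haslead_uniq hd hw.
have hf := haslead_map LP h hd; rewrite ew ed mulr1 in hf.
have [d' hd'] := iter_der_haslead j h.
have := haslead_cmap phiP hd'; rewrite -/(L _) => hf'.
have [_ ed'] := haslead_uniq hf hf'; subst d'.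
exists c, (c^-1 *: L (iter i der s)); rewrite uL; split=> //.
- exact: haslead_lc h.
- have eji : iter (j + i) der s = iter j der (iter i der s) by rewrite iterD.
  by exists phi, s, (j + i)%N, (iter j der_lead v), c; rewrite eji; split.
- by rewrite scalerA mulfV ?scale1r ?hf.1.
by rewrite /normal uL (haslead_lm hf) (haslead_lm h).
Qed.

Lemma term_star w g : term w g -> exists (u : star_word ar X) s i c,
  [/\ S s, subst lam u (lm (iter i der s)) = mono w & g = c *: subst lam u (iter i der s)].
Proof.
move=> [phi [s [l [v [c [phiP Ss h -> ->]]]]]].
have [u uE] := ctx_star lam phiP; exists u, s, l, c^-1; split=> //; rewrite uE //.
by rewrite (haslead_lm h) cmap_mono.
Qed.

Lemma equiv_modP w f g : equiv_mod lam S w f g <-> below_terms w (f - g).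
Proof.
split.
  move=> [n [alpha [u [s [l [-> h]]]]]]; apply: span_sum => k _; apply: spanZ.
  have [Ss _ [v uv vw]] := h k; have [c [g' [_ _ gt -> _]]] := star_term Ss uv.
  by apply: spanZ; apply: span_gen; exists v.
(* The finite families are built as one sequence of quadruples. *)
pose D := (K * star_word ar X * A * nat)%type.
pose val_of (x : D) := x.1.1.1 *: subst lam x.1.1.2 (iter x.2 der x.1.2).
pose ok (x : D) := [/\ S x.1.2, normal lam x.1.1.2 (iter x.2 der x.1.2) &
   exists2 v, subst lam x.1.1.2 (lm (iter x.2 der x.1.2)) = mono v & lt_word v w].
move=> h; suff [r [rE rok]] : exists r : seq D,
    f - g = \sum_(x <- r) val_of x /\ forall k : 'I_(size r), ok (tnth (in_tuple r) k).
  exists (size r), (fun k => (tnth (in_tuple r) k).1.1.1), (fun k => (tnth (in_tuple r) k).1.1.2),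
    (fun k => (tnth (in_tuple r) k).1.2), (fun k => (tnth (in_tuple r) k).2).
  by split=> [|k]; [rewrite rE big_tnth|apply: rok].
elim: h => [|c g' f' [u uw gt] _ [r [-> rok]]].
  by exists [::]; split=> [|[]//]; rewrite big_nil.
have [us [s [i [d [Ss usu ->]]]]] := term_star gt.
exists ((c * d, us, s, i) :: r); split; first by rewrite big_cons /val_of /= scalerA.
move=> k; case: (unliftP ord0 k) => [j|] ->.
  by have := rok j; rewrite !(tnth_nth (c * d, us, s, i)).
rewrite (tnth_nth (c * d, us, s, i)) /=; have [_ [_ [_ _ _ _ nor]]] := star_term Ss usu.
by split=> //; exists u.
Qed.

(** By [star_term] the normality required in the definition of irreducible words
    is automatic, so that they are the words that are not leading words of
    terms. *)
Lemma IrrP w : Irr lam S w <-> forall g, ~ term w g.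
Proof.
split=> [irr g /term_star [u [s [i [c [Ss uw _]]]]]|nt s i u Ss _ e].
  have [_ [_ [_ _ _ _ nor]]] := star_term Ss uw.
  exact: irr Ss nor (esym uw).
by have [_ [g [_ _ gt _ _]]] := star_term Ss (esym e); apply: nt gt.
Qed.

(** * The generated ideal *)

Lemma all_terms_ctx chi f : isctx chi -> all_terms f -> all_terms (cmap chi f).
Proof.
move=> chiP; apply: span_lin; first exact: cmap_lin.
by move=> g [u gt]; apply: span_gen; exists (chi u); apply: term_ctx.
Qed.

Lemma all_terms_mul_l f g : all_terms g -> all_terms (f ** g).
Proof.
move=> gI; apply: (lin_mono_ind (@amul_lin_l _ _ _ _ _ _ g)).
- exact: span0.
- exact: spanD.
- exact: spanZ.
by move=> u _; rewrite cmap_cat_l; apply: all_terms_ctx => //; apply: isctx_cat_l.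
Qed.

Lemma all_terms_mul_r f g : all_terms f -> all_terms (f ** g).
Proof.
move=> fI; apply: (lin_mono_ind (@amul_lin_r _ _ _ _ _ _ f)).
- exact: span0.
- exact: spanD.
- exact: spanZ.
by move=> u _; rewrite cmap_cat_r; apply: all_terms_ctx => //; apply: isctx_cat_r.
Qed.

Lemma all_terms_iter_der s l : S s -> all_terms (iter l der s).
Proof.
move=> Ss; have [w [c [h _]]] := monic_iter_lead l Ss.
rewrite -[iter l der s](scalerKV h.1); apply: spanZ; apply: span_gen; exists w.
by exists id, s, l, w, c; split=> //; [apply: isctx_id|rewrite cmap_id].
Qed.

Lemma all_terms_der_mul f g :
  all_terms g -> all_terms (der g) -> all_terms (der (f ** g)) /\ all_terms (der (g ** f)).
Proof.
move=> gI dgI; split; rewrite der_mul.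
  by apply: spanD; [apply: spanD; [apply: spanZ|]|]; apply: all_terms_mul_l.
by apply: spanD; [apply: spanD; [apply: spanZ|]|]; apply: all_terms_mul_r.
Qed.

(** Letters are added to the context one at a time: by the product rule, if [f] and
    [D(f)] are in the span, so are the products of [f] with a letter and their
    derivatives. *)
Lemma all_terms_der_wrap a b f :
  all_terms f -> all_terms (der f) -> all_terms (der (cmap (fun p => wrap a p b) f)).
Proof.
move=> fI dfI; rewrite (_ : cmap _ f = cmap (fun p => foldr Cons p a)
   (cmap (fun p => foldl (fun w x => cat_word w (Sing x)) p b) f)); last first.
  by rewrite -cmap_comp.
set g := cmap (fun p => foldl _ p b) f.
have [gI dgI] : all_terms g /\ all_terms (der g).
  rewrite {}/g; elim: b f fI dfI => [|y b IH] f fI dfI /=; first by rewrite cmap_id.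
  rewrite (_ : cmap _ f = cmap (fun p => foldl (fun w x => cat_word w (Sing x)) p b)
    (f ** mono (Sing y))); last by rewrite cmap_cat_r -cmap_comp.
  apply: IH; first exact: all_terms_mul_r.
  by apply: (all_terms_der_mul _ fI dfI).2.
suff [] : all_terms (cmap (fun p => foldr Cons p a) g) /\
          all_terms (der (cmap (fun p => foldr Cons p a) g)) by [].
elim: a => [|x a [IH1 IH2]] /=; first by rewrite cmap_id.
rewrite (_ : cmap _ g = mono (Sing x) ** cmap (fun p => foldr Cons p a) g).
  by split; [apply: all_terms_mul_l|apply: (all_terms_der_mul _ IH1 IH2).1].
by rewrite cmap_cat_l -cmap_comp.
Qed.

(** A derivation over an operator is absorbed in the exponent of the letter, so
    only the factors around that letter require the product rule. *)
Lemma all_terms_der_ctx phi f : isctx phi ->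
  all_terms f -> all_terms (der f) -> all_terms (der (cmap phi f)).
Proof.
case=> [a b|a i t us k chi b chiP] fI dfI; first exact: all_terms_der_wrap.
rewrite (_ : cmap _ f = cmap (fun p => wrap a p b) (cmap (op_word i us k) (cmap chi f))).
  apply: all_terms_der_wrap.
    by apply: all_terms_ctx (isctx_op _ _ _ (isctx_id _ _)) _; apply: all_terms_ctx.
  rewrite -[der _]/(iter 1 der _) iter_der_op.
  by apply: all_terms_ctx (isctx_op _ _ _ (isctx_id _ _)) _; apply: all_terms_ctx.
by rewrite -!cmap_comp.
Qed.

Lemma all_terms_der f : all_terms f -> all_terms (der f).
Proof.
apply: span_lin; first exact: der_lin.
move=> g [u [phi [s [l [v [c [phiP Ss _ _ ->]]]]]]].
rewrite (linZ (@der_lin _ _ _ _ _ _ lam)); apply: spanZ.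
apply: all_terms_der_ctx => //; first exact: all_terms_iter_der.
exact: (all_terms_iter_der l.+1).
Qed.

(** The operands other than [k] are expanded into words one after the other, by
    multilinearity; [m] counts the operands that may still be arbitrary. When
    all are words, the operator with the remaining operand is a context. *)
Lemma all_terms_op t (fs : 'I_(ar t) -> A) k : all_terms (fs k) -> all_terms (op fs).
Proof.
(* Without words the algebra is zero; otherwise [w0] serves as a default. *)
move=> fk; have [[w0 _]|now] := pselect (exists w : word, True); last first.
  rewrite (_ : op fs = 0); first exact: span0.
  by apply/malgP => w; case: now; exists w.
suff Q m : forall fs : 'I_(ar t) -> A, all_terms (fs k) ->
    (forall i : 'I_(ar t), (m <= i)%N -> i != k -> exists v, fs i = mono v) -> all_terms (op fs).
  by apply: (Q (ar t) fs fk) => i; rewrite leqNgt ltn_ord.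
elim: m => [|m IH] {}fs {}fk h.
  have /choice [vs vsE] : forall i, exists v, i != k -> fs i = mono v.
    move=> i; have [->|ik] := eqVneq i k; first by exists w0.
    by have [v vE] := h i (leq0n _) ik; exists v.
  rewrite (_ : fs = upd (fun i => mono (vs i)) k (fs k)).
    by rewrite op_cmap; apply: all_terms_ctx fk; apply: (isctx_op _ _ _ (isctx_id _ _)).
  by apply: funext => i; rewrite /upd; case: eqP => [->|/eqP /vsE].
have [mt|mt] := ltnP m (ar t); last first.
  by apply: IH => // i mi; have := leq_trans mt mi; rewrite leqNgt ltn_ord.
pose i0 := Ordinal mt; have [ei|ne] := eqVneq i0 k.
  apply: IH => // i mi ik; apply: h => //; rewrite ltn_neqAle mi andbT.
  by apply: contraNneq ik => e; rewrite -ei -val_eqE /= e.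
rewrite (_ : fs = upd fs i0 (fs i0)); last first.
  by apply: funext => i; rewrite /upd; case: eqP => [->|].
apply: (lin_mono_ind (L := fun f => op (upd fs i0 f)) (op_lin fs i0)).
- exact: span0.
- exact: spanD.
- exact: spanZ.
move=> u _; apply: IH; first by rewrite /upd eq_sym (negPf ne).
move=> i mi ik; rewrite /upd; case: eqP => [_|/eqP nei]; first by exists u.
apply: h => //; rewrite ltn_neqAle mi andbT.
by apply: contra_neq nei => e; apply: val_inj.
Qed.

Lemma IdP f : Id lam S f <-> all_terms f.
Proof.
split.
  apply; last first.
    by move=> s /(all_terms_iter_der 0).
  split.
  - by split; [exact: span0|exact: spanD|exact: spanZ].
  - by move=> f1 g1 fI; split; [apply: all_terms_mul_r|apply: all_terms_mul_l].
  - exact: all_terms_der.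
  - by move=> t fs i; apply: all_terms_op.
move=> fI I [[I0 ID IZ] IM Ider Iop] SI.
elim: fI => [//|c g f' [u [phi [s [l [v [d [phiP Ss _ _ ->]]]]]]] _ If'].
apply: ID If'; apply: (IZ); apply: (IZ).
have : I (iter l der s) by elim: (l) => [|n IH]; [apply: SI|apply: Ider].
move: (iter l der s) => h.
have Iw a b g' : I g' -> I (cmap (fun p => wrap a p b) g').
  move=> Ig; elim: a => [|x a IH].
    elim: b g' Ig => [|y b IH] g' Ig; first by rewrite cmap_id.
    rewrite (_ : cmap _ g' = cmap (fun p => wrap [::] p b) (g' ** mono (Sing y))).
      by apply: IH; apply: (IM _ _ Ig).1.
    by rewrite cmap_cat_r -cmap_comp.
  rewrite (_ : cmap _ g' = mono (Sing x) ** cmap (fun p => wrap a p b) g').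
    exact: (IM _ _ IH).2.
  by rewrite cmap_cat_l -cmap_comp.
elim: phiP h => [a b|a i t us k chi b chiP IH] h Ih; first exact: Iw.
rewrite (_ : cmap _ h = cmap (fun p => wrap a p b) (cmap (op_word i us k) (cmap chi h))).
  apply: Iw; rewrite -[i]addn0 -(iter_der_op lam) -op_cmap.
  suff : I (op (upd (fun j => mono (us j)) k (cmap chi h))).
    by elim: (i) => [//|n IHn] /IHn; apply: Ider.
  by apply: (Iop _ _ k); rewrite /upd eqxx; apply: IH.
by rewrite -!cmap_comp.
Qed.

(** * Reduction *)

Hypothesis O_wf : well_founded (fun t d : O => (t < d)%O).
Hypothesis X_wf : well_founded (fun x y : X => (x < y)%O).

Lemma below_lead_or0 w f : below w f -> f = 0 \/ exists u c, lt_word u w /\ haslead f u c.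
Proof.
have [->|f0] := pselect (f = 0); first by left.
move=> bf; right; have [u [c h]] := haslead_ex f0; exists u, c; split=> //.
by apply: bf; rewrite (haslead_coef h) h.1.
Qed.

(** Well-founded induction on the bound: the leading word is kept if it is
    irreducible, and otherwise it is removed by subtracting a term. The bound on
    the terms used is what the proof of (I) from (III) needs. *)
Lemma reduction w f : below w f -> exists g, supported (Irr lam S) g /\ below_terms w (f - g).
Proof.
elim/(well_founded_ind (lt_word_wf (ar := ar) O_wf X_wf)): w f => w IH f /below_lead_or0 [->|[u [c [uw h]]]].
  exists 0; split; first by move=> v; rewrite -mcoeff_neq0 mcoeff0 eqxx.
  by rewrite subrr; apply: span0.
have [nt|/existsNP [g /contrapT gt]] := pselect (forall g, ~ term u g).
  have [g [gI gb]] := IH u uw _ h.2; exists (c *: mono u + g); split.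
    move=> v; rewrite -mcoeff_neq0 mcoeffD mcoeffZ mcoeff_mono.
    have [<-|_] := eqVneq u v; first by move=> _; apply/IrrP.
    by rewrite mulr0 add0r mcoeff_neq0; apply: gI.
  by rewrite opprD addrA; apply: below_terms_lt uw gb.
have [|g' [gI gb]] := IH u uw (f - c *: g).
  rewrite (_ : f - c *: g = (f - c *: mono u) - c *: (g - 1 *: mono u)).
    by apply: belowD; [apply: h.2|rewrite -scaleNr; apply: belowZ; apply: (term_lead gt).2].
  by rewrite scale1r scalerBr opprB addrA subrK.
exists g'; split=> //; rewrite (_ : f - g' = c *: g + (f - c *: g - g')).
  by apply: span_cons; [exists u|apply: below_terms_lt uw gb].
by rewrite addrAC [c *: g + _]addrC subrK.
Qed.

(** * Confluence *)

Definition GS : Prop := forall f g w h,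
  S f -> S g -> composition lam f g w h -> below_terms w h.

Lemma GS_basisP : GS_basis lam S <-> GS.
Proof.
split=> gs f g w h Sf Sg /(gs f g w h Sf Sg).
  by move/equiv_modP; rewrite subr0.
by move=> hb; apply/equiv_modP; rewrite subr0.
Qed.

Lemma haslead_monic f w c : haslead f w c -> haslead (c^-1 *: f) w 1.
Proof. by move=> h; rewrite -(mulVf h.1); apply: (haslead_scale _ h); rewrite invr_eq0 h.1. Qed.

(** For a two-hole context [Pi], its bilinear extension [Pi[f,g]] interpolates
    between the two terms to be compared. *)
Section Disjoint.
Variable Pi : word -> word -> word.
Hypothesis Pi_l : forall q, isctx (Pi^~ q).
Hypothesis Pi_r : forall p, isctx (Pi p).

Definition biext f g : A := lin_ext (fun p => cmap (Pi p) g) f.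

Lemma biext_lin_l g : is_linear (biext^~ g).
Proof. exact: lin_ext_lin. Qed.

Lemma biext_mono_l p g : biext (mono p) g = cmap (Pi p) g.
Proof. exact: lin_ext_mono. Qed.

Lemma biext_mono_r f q : biext f (mono q) = cmap (Pi^~ q) f.
Proof.
apply: (@lin_eq _ _ _ _ _ _ (biext^~ (mono q)) (cmap (Pi^~ q))) => [||p].
- exact: biext_lin_l.
- exact: cmap_lin.
by rewrite biext_mono_l !cmap_mono.
Qed.

Lemma biext_lin_r f : is_linear (biext f).
Proof.
move=> c g g'.
pose L f := c *: biext f g + biext f g'.
apply: (@lin_eq _ _ _ _ _ _ (biext^~ (c *: g + g')) L) => [||p].
- exact: biext_lin_l.
- by apply: lin_add; [apply: lin_scale|]; apply: biext_lin_l.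
by rewrite /L !biext_mono_l cmap_lin.
Qed.

(** [Pi[f,q] - Pi[p,g] = Pi[f-p,g] - Pi[f,g-q]], and on the right the words of
    [f-p] and [g-q] are below [p] and [q], so that each summand is a term with a
    smaller leading word. *)
Lemma disjoint_terms p q f g :
  haslead f p 1 -> haslead g q 1 ->
  (forall r, term (Pi p r) (cmap (Pi^~ r) f)) -> (forall r, term (Pi r q) (cmap (Pi r) g)) ->
  below_terms (Pi p q) (cmap (Pi^~ q) f - cmap (Pi p) g).
Proof.
move=> hf hg tf tg.
have bf : below p (f - mono p) by rewrite -[mono p]scale1r; apply: hf.2.
have bg : below q (g - mono q) by rewrite -[mono q]scale1r; apply: hg.2.
have -> : cmap (Pi^~ q) f - cmap (Pi p) g = biext (f - mono p) g - biext f (g - mono q).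
  rewrite (linB (biext_lin_l g)) (linB (biext_lin_r f)) biext_mono_l biext_mono_r.
  by rewrite opprB [RHS]addrC addrA subrK.
apply: spanD; last apply: spanN.
  apply: (lin_mono_ind (biext_lin_l g)); [exact: span0|exact: spanD|exact: spanZ|].
  move=> r; rewrite -mcoeff_neq0 => /bf rp; rewrite biext_mono_l.
  by apply: span_gen; exists (Pi r q); [apply: lt_ctx (Pi_l q) rp|apply: tg].
apply: (lin_mono_ind (biext_lin_r f)); [exact: span0|exact: spanD|exact: spanZ|].
move=> r; rewrite -mcoeff_neq0 => /bg rq; rewrite biext_mono_r.
by apply: span_gen; exists (Pi p r); [apply: lt_ctx (Pi_r p) rq|apply: tf].
Qed.

End Disjoint.

(** An including composition, with the star word of the context [chi]. *)
Lemma inside_terms (gs : GS) s1 s2 l1 l2 v1 v2 c1 c2 chi :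
  S s1 -> S s2 -> haslead (iter l1 der s1) v1 c1 -> haslead (iter l2 der s2) v2 c2 ->
  isctx chi -> v1 = chi v2 ->
  below_terms v1 (c1^-1 *: iter l1 der s1 - c2^-1 *: cmap chi (iter l2 der s2)).
Proof.
move=> S1 S2 h1 h2 chiP e; have [u uE] := ctx_star lam chiP.
rewrite -uE -(haslead_lc h1) -(haslead_lc h2); apply: (gs s1 s2) => //.
apply: Including; first by rewrite (haslead_lm h1).
by rewrite (haslead_lm h2) uE cmap_mono e.
Qed.

(** An intersection composition. Derivation preserves breadth, so the bound on the
    breadth can be stated for the leading words of the derivatives. *)
Lemma cross_terms (gs : GS) s1 s2 l1 l2 v1 v2 c1 c2 a b :
  S s1 -> S s2 -> haslead (iter l1 der s1) v1 c1 -> haslead (iter l2 der s2) v2 c2 ->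
  cat_word v1 a = cat_word b v2 -> (bre (cat_word v1 a) < bre v1 + bre v2)%N ->
  below_terms (cat_word v1 a) (c1^-1 *: cmap (fun r => cat_word r a) (iter l1 der s1)
     - c2^-1 *: cmap (cat_word b) (iter l2 der s2)).
Proof.
move=> S1 S2 h1 h2 e lt1.
rewrite -cmap_cat_r -cmap_cat_l -(haslead_lc h1) -(haslead_lc h2); apply: (gs s1 s2) => //.
have bE s l v c : S s -> haslead (iter l der s) v c -> bre_lead s = bre v.
  move=> Ss h; have [v' [c' [h' <-]]] := monic_iter_lead l Ss.
  by have [-> _] := haslead_uniq h h'.
apply: Intersection.
- by rewrite (haslead_lm h1) amul_mono.
- by rewrite (haslead_lm h2) amul_mono e.
by rewrite (bE _ _ _ _ S1 h1) (bE _ _ _ _ S2 h2).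
Qed.

(** In the nested and overlapping cases the difference is a composition placed in
    a context, and contexts preserve smallness ([below_terms_ctx]). *)
Lemma confluence (gs : GS) w g1 g2 : term w g1 -> term w g2 -> below_terms w (g1 - g2).
Proof.
move=> [phi1 [s1 [l1 [v1 [c1 [P1 S1 h1 -> ->]]]]]] [phi2 [s2 [l2 [v2 [c2 [P2 S2 h2 e ->]]]]]].
have catC chi phi c f : c *: cmap (chi \o phi) f = cmap chi (c *: cmap phi f).
  by rewrite (linZ (@cmap_lin _ _ _ _ _ _ _)) cmap_comp.
have catB chi f g : cmap chi f - cmap chi g = cmap chi (f - g).
  by rewrite (linB (@cmap_lin _ _ _ _ _ _ _)).
have swap f g : below_terms (phi1 v1) (g - f) -> below_terms (phi1 v1) (f - g).
  by move=> h; rewrite -opprB; apply: spanN.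
case: (ctx_overlap P1 P2 e) => [Pi Pr Pl e1 e2|chi chiP e2 ev|chi chiP e1 ev
    |chi a b chiP ew lt1 e1 e2|chi a b chiP ew lt1 e2 e1].
- rewrite e1 e2 -!(linZ (@cmap_lin _ _ _ _ _ _ _)).
  apply: (disjoint_terms Pl Pr (haslead_monic h1) (haslead_monic h2)) => r.
    by exists (Pi^~ r), s1, l1, v1, c1; rewrite (linZ (@cmap_lin _ _ _ _ _ _ _)).
  by exists (Pi r), s2, l2, v2, c2; rewrite (linZ (@cmap_lin _ _ _ _ _ _ _)).
- rewrite e2 (catC phi1 chi) -(linZ (@cmap_lin _ _ _ _ _ _ phi1)) catB.
  exact: (below_terms_ctx P1 (inside_terms gs S1 S2 h1 h2 chiP ev)).
- apply: swap; rewrite e e1 (catC phi2 chi) -(linZ (@cmap_lin _ _ _ _ _ _ phi2)) catB.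
  exact: (below_terms_ctx P2 (inside_terms gs S2 S1 h2 h1 chiP ev)).
- rewrite e1 e2 (catC chi (fun r => cat_word r a)) (catC chi (cat_word b)) catB.
  exact: (below_terms_ctx chiP (cross_terms gs S1 S2 h1 h2 ew lt1)).
apply: swap; rewrite e e1 e2 (catC chi (fun r => cat_word r a)) (catC chi (cat_word b)) catB.
exact: (below_terms_ctx chiP (cross_terms gs S2 S1 h2 h1 ew lt1)).
Qed.

Lemma merge_multiples (V : lmodType K) (c d : K) (x y z : V) :
  c *: x + (d *: y + z) = (c + d) *: y + (c *: (x - y) + z).
Proof.
rewrite scalerDl scalerBr !addrA; congr (_ + z).
by rewrite [RHS](ACl ((1 * 4) * (3 * 2))) /= subrr add0r.
Qed.

(** Terms are added one at a time. When the new term has the same leading word as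
    the previous largest one, confluence replaces it by that one. *)
Lemma below_terms_top (gs : GS) w f : below_terms w f ->
  f = 0 \/ exists u c g f', [/\ lt_word u w, term u g, f = c *: g + f' & below_terms u f'].
Proof.
elim=> [|c g f' [u uw gt] _ [->|[v [d [g' [f'' [vw gt' -> hf]]]]]]]; first by left.
  by right; exists u, c, g, 0; split; [exact: uw|exact: gt|exact: erefl|exact: span0].
right; case: (lt_word_total u v) => [e|uv|vu].
- subst v; exists u, (c + d), g', (c *: (g - g') + f'').
  split; [exact: uw|exact: gt'|exact: merge_multiples|].
  by apply: (spanD _ hf); apply: spanZ; apply: confluence.
- exists v, d, g', (c *: g + f''); split; [exact: vw|exact: gt'|exact: addrCA|].
  by apply: span_cons hf; exists u.
exists u, c, g, (d *: g' + f''); split; [exact: uw|exact: gt|exact: erefl|].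
by apply: span_cons; [exists v|apply: below_terms_lt vu hf].
Qed.

(** If the coefficient of the largest term is 0, the element is a combination of
    smaller terms; this stops as the order is well founded. *)
Lemma below_terms_lead (gs : GS) w f : below_terms w f -> f <> 0 ->
  exists u c g, haslead f u c /\ term u g.
Proof.
elim/(well_founded_ind (lt_word_wf (ar := ar) O_wf X_wf)): w f => w IH f.
move=> /(below_terms_top gs) [//|[u [c [g [f' [uw gt -> hf']]]]]] f0.
have [c0|c0] := eqVneq c 0.
  by apply: (IH u uw) f0; rewrite c0 scale0r add0r.
exists u, c, g; split=> //; rewrite -[c]mulr1.
apply: haslead_add (below_terms_below hf'); rewrite mulr1 -[X in haslead _ _ X]mulr1.
exact: haslead_scale c0 (term_lead gt).
Qed.

Lemma lt_cat_self u v : lt_word u (cat_word u v).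
Proof.
apply/lt_wordE; rewrite degW_cat bre_cat.
have b : (bre u < bre u + bre v)%N by rewrite -[X in (X < _)%N]addn0 ltn_add2l bre_gt0.
have [-> | d] := posnP (degW v); first by right; rewrite addn0; split=> //; left.
by left; rewrite -[X in (X < _)%N]addn0 ltn_add2l.
Qed.

(** A word [u] is below [uu], and among finitely many words there is a largest, so
    finitely many terms have a common strict upper bound. *)
Lemma all_below f : all_terms f -> f <> 0 -> exists w, below_terms w f.
Proof.
move=> h; suff : f = 0 \/ exists w, below_terms w f by case.
elim: h => [|c g f' [u gt] _ IH]; first by left.
right; have uu := lt_cat_self u u.
have one w : lt_word u w -> below_terms w f' -> below_terms w (c *: g + f').
  by move=> uw hf; apply: span_cons hf; exists u.
case: IH => [e|[w hw]]; first by exists (cat_word u u); apply: one; rewrite ?e //; apply: span0.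
case: (lt_word_total u w) => [e|uw|wu].
- by exists (cat_word u u); apply: one => //; apply: below_terms_lt hw; rewrite -e.
- by exists w; apply: one.
by exists (cat_word u u); apply: one => //; apply: below_terms_lt hw; apply: lt_word_trans uu.
Qed.

Definition leading_terms : Prop :=
  forall f, Id lam S f -> f <> 0 -> exists u c g, haslead f u c /\ term u g.

Lemma leading_termsP : leading_terms <->
  (forall f, Id lam S f -> f <> 0 ->
     exists (u : star_word ar X) s (i : nat),
       S s /\ lm f = subst lam u (lm (iter i der s))).
Proof.
split=> lt f fI f0.
  have [w [c [g [h /term_star [u [s [i [d [Ss us _]]]]]]]]] := lt f fI f0.
  by exists u, s, i; split=> //; rewrite us (haslead_lm h).
have [u [s [i [Ss e]]]] := lt f fI f0; have [w [c h]] := haslead_ex f0.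
rewrite (haslead_lm h) in e.
by have [_ [g [_ _ gt _ _]]] := star_term Ss (esym e); exists w, c, g.
Qed.

Lemma GS_leading : GS -> leading_terms.
Proof.
move=> gs f /IdP fI f0; have [w hw] := all_below fI f0.
exact: (below_terms_lead gs hw f0).
Qed.

(** * The quotient *)

Local Notation quot_proj := (@quot_proj _ _ O ar X K lam S).

Lemma quot_projD f g : quot_proj (f + g) = quot_proj f + quot_proj g.
Proof. exact: lmod_projD. Qed.

Lemma quot_projZ c f : quot_proj (c *: f) = c *: quot_proj f.
Proof. by symmetry; apply: quot_scaleE. Qed.

Lemma quot_proj0 : quot_proj 0 = 0.
Proof. by have := quot_projZ 0 0; rewrite !scale0r. Qed.

Lemma quot_proj_eq f g : quot_proj f = quot_proj g <-> Id lam S (f - g).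
Proof.
split; first by move/lmod_projE => h; apply/asboolP.
by move=> h; apply/lmod_projE; apply/asboolP.
Qed.

Lemma lincomb_quot c : lincomb (fun w => quot_proj (mono w)) c = quot_proj c.
Proof.
rewrite /lincomb [in RHS](malg_expand c).
elim: (enum_fset (msupp c)) => [|u r IH]; first by rewrite !big_nil quot_proj0.
by rewrite !big_cons quot_projD quot_projZ IH.
Qed.

Definition irr_basis : Prop := is_basis (Irr lam S) (fun w => quot_proj (mono w)).

Lemma leading_irr_basis : leading_terms -> irr_basis.
Proof.
move=> lt; split=> [c irr|v].
  rewrite lincomb_quot -quot_proj0 => /quot_proj_eq; rewrite subr0 => cI.
  apply: contrapT => c0; have [w [d [g [h gt]]]] := lt c cI c0.
  have /IrrP/(_ g) : Irr lam S w by apply: irr; rewrite -mcoeff_neq0 (haslead_coef h) h.1.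
  exact.
have [f ->] := lmod_proj_surj v; have [f0|f0] := pselect (f = 0).
  exists 0; first by move=> w; rewrite -mcoeff_neq0 mcoeff0 eqxx.
  by rewrite lincomb_quot f0.
have [u [c h]] := haslead_ex f0.
have [g [gI gb]] := reduction (haslead_le_below h (lt_cat_self u u)).
exists g => //; rewrite lincomb_quot; apply/quot_proj_eq/IdP.
exact: below_all gb.
Qed.

Lemma below_sub f g w c : haslead f w c -> haslead g w c -> below w (f - g).
Proof.
move=> [_ hf] [_ hg]; rewrite (_ : f - g = (f - c *: mono w) + (-1) *: (g - c *: mono w)).
  by apply: belowD => //; apply: belowZ.
by rewrite scaleN1r opprB addrA subrK.
Qed.

(** The two leading words are equal to [w], with coefficient 1, and cancel. *)
Lemma composition_below f g w h : S f -> S g -> composition lam f g w h -> below w h.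
Proof.
move=> Sf Sg; case=> [i j a b w' e1 e2 _|i j u w' e1 e2].
  have [v1 [c1 [h1 _]]] := monic_iter_lead i Sf.
  have [v2 [c2 [h2 _]]] := monic_iter_lead j Sg.
  rewrite (haslead_lc h1) (haslead_lc h2).
  rewrite (haslead_lm h1) amul_mono in e1; rewrite (haslead_lm h2) amul_mono in e2.
  rewrite cmap_cat_r cmap_cat_l.
  have k1 := haslead_monic (haslead_cmap (isctx_cat_r a) h1).
  have k2 := haslead_monic (haslead_cmap (isctx_cat_l b) h2).
  rewrite -(mono_word_inj e1) in k1; rewrite -(mono_word_inj e2) in k2.
  exact: below_sub k1 k2.
have [v1 [c1 [h1 _]]] := monic_iter_lead i Sf.
rewrite (haslead_lm h1) in e1; rewrite -(mono_word_inj e1) in h1.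
have [c2 [g' [-> h2 _ _ _]]] := star_term Sg (esym e2).
rewrite (haslead_lc h1).
exact: below_sub (haslead_monic h1) (haslead_monic h2).
Qed.

Lemma composition_Id f g w h : S f -> S g -> composition lam f g w h -> all_terms h.
Proof.
move=> Sf Sg; case=> [i j a b w' _ _ _|i j u w' _ e2].
  apply: spanD; last apply: spanN; apply: spanZ.
    by apply: all_terms_mul_r; apply: all_terms_iter_der.
  by apply: all_terms_mul_l; apply: all_terms_iter_der.
apply: spanD; last apply: spanN; apply: spanZ; first exact: all_terms_iter_der.
have [c [g' [_ _ gt -> _]]] := star_term Sg (esym e2).
by apply: spanZ; apply: span_gen; exists w'.
Qed.

(** The remainder [r] of the composition is in [Id S] and irreducible, hence 0 by
    independence. *)
Lemma irr_basis_GS : irr_basis -> GS.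
Proof.
move=> [indep _] f g w h Sf Sg comp.
have [r [rI rb]] := reduction (composition_below Sf Sg comp).
suff r0 : r = 0 by rewrite r0 subr0 in rb.
apply: indep => //; rewrite lincomb_quot -quot_proj0; apply/quot_proj_eq/IdP.
rewrite subr0 -[r](subKr h); apply: spanD; first exact: composition_Id comp.
by apply: spanN; apply: below_all rb.
Qed.

End CompositionDiamond.

Theorem theorem3p6 (dO dX : Order.disp_t)
  (O : orderType dO) (O_wf : well_founded (fun t d : O => (t < d)%O))
  (ar : O -> nat) (ar_gt0 : forall theta : O, (0 < ar theta)%N)
  (X : orderType dX) (X_wf : well_founded (fun x y : X => (x < y)%O))
  (K : fieldType) (lam : K)
  (S : DXO ar X K -> Prop) (S_monic : forall s, S s -> is_monic s) :
  (GS_basis lam S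
   <-> (forall f, Id lam S f -> f <> 0 ->
          exists (u : star_word ar X) (s : DXO ar X K) (i : nat),
            S s /\ lm f = subst lam u (lm (iter i (der lam) s))))
  /\
  (GS_basis lam S
   <-> is_basis (Irr lam S) (fun w => quot_proj lam S (mono K w))).
Proof.
have h12 := GS_leading S_monic O_wf X_wf.
have h23 := leading_irr_basis S_monic O_wf X_wf.
have h31 := irr_basis_GS S_monic O_wf X_wf.
split.
  split=> [/GS_basisP gs|/leading_termsP lt]; first exact/leading_termsP/h12/gs.
  exact/GS_basisP/h31/h23/lt.
split=> [/GS_basisP gs|b]; first exact/h23/h12/gs.
exact/GS_basisP/h31/b.
Qed.
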